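(* Let $\alpha\in\mathbb R\setminus\{0,1\}$. Suppose either $\lambda=\alpha$ and $\alpha\notin\mathbb N$, or $\lambda=1$ and $\alpha^{-1}\notin\mathbb N$. Then, with all modules given by the Fock representation $\rho_\lambda$: (1)(a) If $\alpha\neq-1$, then for every $k\ge1$ an explicit decomposition of $F_{\lambda,k}$ into irreducible $\mathfrak k_0$-modules is given by $F_{\lambda,k}=H_{\lambda,k}\oplus\mathbb C(z_1+z_2)^k$. (1)(b) If $\alpha=-1$, then for every $k\ge1$, $F_{\lambda,k}$ is an indecomposable $\mathfrak k_0$-module, but not an irreducible $\mathfrak k_0$-module. (2) $F_{\lambda,k}$ is an irreducible $\mathfrak k$-module (for every $k\geq 0$). (3) $F_\lambda$ is an irreducible $\mathfrak g$-module and its $\mathfrak k$-type decomposition is $F_\lambda=\bigoplus_{k=0}^\infty F_{\lambda,k}$.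
   Context: $\mathbb N=\{0,1,2,\dots\}$. $\mathcal P(\mathbb C^{2|2})=\mathbb C[z_1,z_2]\otimes\Lambda(z_3,z_4)$, with $z_1,z_2$ even and $z_3,z_4$ odd; $\partial_i=\partial_{z_i}$ are the (left) partial superderivatives. The Bessel operators are $\mathcal B_\lambda(z_1)=(-\lambda+z_1\partial_1+z_3\partial_3+z_4\partial_4)\partial_1-2\alpha z_2\partial_3\partial_4$, $\mathcal B_\lambda(z_2)=(-\tfrac{\lambda}{\alpha}+z_2\partial_2+z_3\partial_3+z_4\partial_4)\partial_2-2z_1\partial_3\partial_4$, $\mathcal B_\lambda(z_3)=(-2\lambda+2z_1\partial_1+2\alpha z_2\partial_2+2(1+\alpha)z_3\partial_3)\partial_4+z_3\partial_1\partial_2$, $\mathcal B_\lambda(z_4)=(2\lambda-2z_1\partial_1-2\alpha z_2\partial_2-2(1+\alpha)z_4\partial_4)\partial_3+z_4\partial_1\partial_2$. $\mathcal I_\lambda$ is the ideal of $\mathcal P(\mathbb C^{2|2})$ generated by $2z_1z_2+z_3z_4,\ z_2^2,\ z_2z_3,\ z_2z_4$ if $\lambda=\alpha$, and by $2\alpha z_1z_2+z_3z_4,\ z_1^2,\ z_1z_3,\ z_1z_4$ if $\lambda=1$. We work in $\mathcal P(\mathbb C^{2|2})/\mathcal I_\lambda$. $D_\alpha$ is the real Jordan superalgebra with even basis $e_1,e_2$, odd basis $\xi,\eta$ and supercommutative product $e_ie_i=e_i$, $e_1e_2=0$, $e_i\xi=\frac12\xi$, $e_i\eta=\frac12\eta$,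 $\xi\eta=e_1+\alpha e_2$. $L_a$ is left multiplication by $a$, $\mathrm{Der}(D_\alpha)$ the space of (super)derivations, $\mathfrak{str}(D_\alpha)=\{L_a\}\oplus\mathrm{Der}(D_\alpha)\subset\mathrm{End}(D_\alpha)$ with supercommutator bracket. $\mathfrak g=\mathrm{TKK}(D_\alpha)=D_\alpha^-\oplus\mathfrak{str}(D_\alpha)\oplus D_\alpha^+\ (\cong D(2,1;\alpha))$ with $D_\alpha^\pm$ copies of $D_\alpha$ (write $a^\pm$), and brackets $[L_a,x^+]=(ax)^+$, $[D,x^+]=(Dx)^+$, $[L_a,u^-]=-(au)^-$, $[D,u^-]=(Du)^-$, $[x^+,u^-]=2L_{xu}+2[L_x,L_u]$, $[D_\alpha^\pm,D_\alpha^\pm]=0$ ($D\in\mathrm{Der}(D_\alpha)$). Subalgebras: $\mathfrak k=\{a^-+I-a^+\mid a\in D_\alpha,\ I\in\mathrm{Der}(D_\alpha)\}$ and $\mathfrak k_0=\mathrm{Der}(D_\alpha)$. Let $a\mapsto z_a$ be the linear map with $e_1,e_2,\xi,\eta\mapsto z_1,z_2,z_3,z_4$, extend $\mathcal B_\lambda(z_a)$ linearly in $a$, and for $T\in\mathrm{End}(D_\alpha)$ let $\partial_T$ be the superderivation of $\mathcal P(\mathbb C^{2|2})$ (of the parity of $T$) with $\partial_T(z_b)=z_{T(b)}$. Put $\pi_\lambda(L_a)=\lambda(L_a)-\partial_{L_a}$, where $\lambda(2L_{e_1})=\lambda$, $\lambda(2L_{e_2})=\lambda/\alpha$, $\lambda(L_\xi)=\lambda(L_\eta)=0$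 (extended linearly). The Fock representation is $\rho_\lambda(a^-)=-\frac{\imath}{2}(z_a+\mathcal B_\lambda(z_a))+\imath\,\pi_\lambda(L_a)$, $\rho_\lambda(a^+)=-\frac{\imath}{2}(z_a+\mathcal B_\lambda(z_a))-\imath\,\pi_\lambda(L_a)$, $\rho_\lambda(2L_a)=z_a-\mathcal B_\lambda(z_a)$, $\rho_\lambda(D)=\partial_D$; it preserves $\mathcal I_\lambda$ and acts on $\mathcal P(\mathbb C^{2|2})/\mathcal I_\lambda$. $F_\lambda=U(\mathfrak g)1\bmod\mathcal I_\lambda$ is the submodule generated by the constant $1$ (complex span). $F_{\lambda,0}=\mathbb C$, and for $k\ge1$: $F_{\lambda,k}=(\mathbb Cz_1\oplus\mathbb Cz_2\oplus\mathbb Cz_3\oplus\mathbb Cz_4)z_i^{k-1}$ with $i=1$ if $\lambda=\alpha$, $i=2$ if $\lambda=1$; $H_{\alpha,k}=(\mathbb C(z_1+(k-1-\alpha)z_2)\oplus\mathbb Cz_3\oplus\mathbb Cz_4)z_1^{k-1}$; $H_{1,k}=(\mathbb C(z_2+(k-1-\alpha^{-1})z_1)\oplus\mathbb Cz_3\oplus\mathbb Cz_4)z_2^{k-1}$ (all modulo $\mathcal I_\lambda$). *)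

(* Defs.v *)
From HB Require Import structures.
From mathcomp Require Import all_boot all_order all_algebra.
From mathcomp Require Import boolp classical_sets reals complex mpoly.
From mathcomp Require Import ring.

Set Implicit Arguments.
Unset Strict Implicit.
Unset Printing Implicit Defensive.

Import Order.TTheory GRing.Theory Num.Theory.
Local Open Scope ring_scope.
Local Open Scope complex_scope.
Local Open Scope quotient_scope.
Local Open Scope classical_set_scope.

(* K[z1, z2] (x) Lambda(z3, z4): the value at (a, b) is the coefficient, in
   K[z1, z2], of z3^a z4^b. *)
Definition spoly (K : comNzRingType) : Type :=
  {ffun bool * bool -> {mpoly K[2]}}.

Section SuperPolynomials.
Variable K : comNzRingType.
Local Notation P := (spoly K).
Implicit Types (p q r : P) (t : bool).

HB.instance Definition _ :=
  GRing.Lmodule.copy P {ffun bool * bool -> {mpoly K[2]}}.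

Definition sone : P := [ffun u => (u == (false, false))%:R].

Definition smul p q : P := [ffun u =>
  match u with
  | (false, false) => p (false, false) * q (false, false)
  | (true, false) =>
      p (false, false) * q (true, false) + p (true, false) * q (false, false)
  | (false, true) =>
      p (false, false) * q (false, true) + p (false, true) * q (false, false)
  | (true, true) =>
      p (false, false) * q (true, true) + p (true, true) * q (false, false)
      + p (true, false) * q (false, true) - p (false, true) * q (true, false)
  end].

Fact smulA : associative smul.
Proof. by move=> p q r; apply/ffunP=> -[[] []]; rewrite !ffunE; ring. Qed.

Fact smul1p : left_id sone smul.
Proof. by move=> p; apply/ffunP=> -[[] []]; rewrite !ffunE /=; ring. Qed.

Fact smulp1 : right_id sone smul.
Proof. by move=> p; apply/ffunP=> -[[] []]; rewrite !ffunE /=; ring. Qed.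

Fact smulDl : left_distributive smul +%R.
Proof. by move=> p q r; apply/ffunP=> -[[] []]; rewrite !ffunE; ring. Qed.

Fact smulDr : right_distributive smul +%R.
Proof. by move=> p q r; apply/ffunP=> -[[] []]; rewrite !ffunE; ring. Qed.

Fact sone_neq0 : sone != 0.
Proof.
apply/eqP=> /ffunP/(_ (false, false)); rewrite !ffunE /= => /eqP.
by rewrite oner_eq0.
Qed.

HB.instance Definition _ := GRing.Zmodule_isNzRing.Build P
  smulA smul1p smulp1 smulDl smulDr sone_neq0.

Fact sscaleAl (c : K) p q : c *: (p * q) = (c *: p) * q.
Proof.
by apply/ffunP=> -[[] []]; rewrite !ffunE -?scalerAl; rewrite -!mul_mpolyC; ring.
Qed.

HB.instance Definition _ := GRing.Lmodule_isLalgebra.Build K P sscaleAl.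

Fact sscaleAr (c : K) p q : c *: (p * q) = p * (c *: q).
Proof.
by apply/ffunP=> -[[] []]; rewrite !ffunE -?scalerAl; rewrite -!mul_mpolyC; ring.
Qed.

HB.instance Definition _ := GRing.Lalgebra_isAlgebra.Build K P sscaleAr.

Definition z1 : P := [ffun u => if u == (false, false) then 'X_0 else 0].
Definition z2 : P := [ffun u => if u == (false, false) then 'X_1 else 0].
Definition z3 : P := [ffun u => (u == (true, false))%:R].
Definition z4 : P := [ffun u => (u == (false, true))%:R].

(* Left superderivatives; in particular d4 (z3 * z4) = - z3. *)
Definition d1 p : P := [ffun u => (p u)^`M(0)].
Definition d2 p : P := [ffun u => (p u)^`M(1)].
Definition d3 p : P := [ffun u => if u.1 then 0 else p (true, u.2)].
Definition d4 p : P :=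
  [ffun u => if u.2 then 0 else if u.1 then - p (true, true) else p (false, true)].

Definition zz : 'I_4 -> P := tnth [tuple z1; z2; z3; z4].
Definition dd : 'I_4 -> P -> P := tnth [tuple d1; d2; d3; d4].

Definition sparity t p := forall u, u.1 (+) u.2 != t -> p u = 0.

Definition dpar (i : 'I_4) : bool := (1 < i)%N.

Fact sparityP s p : sparity s p ->
  p (false, ~~ s) = 0 /\ p (true, s) = 0.
Proof. by case: s => hp; rewrite !hp. Qed.

Fact smulC s t p q : sparity s p -> sparity t q ->
  p * q = (-1) ^+ (s && t) *: (q * p).
Proof.
move=> /sparityP[] + + /sparityP[]; case: s; case: t => /= p1 p2 q1 q2;
  apply/ffunP=> -[[] []]; rewrite !ffunE /= ?expr1 ?expr0 ?scale1r ?scaleN1r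
    ?p1 ?p2 ?q1 ?q2; ring.
Qed.

Fact dd_leibniz j s p q : sparity s p ->
  dd j (p * q) = dd j p * q + (-1) ^+ (dpar j && s) *: (p * dd j q).
Proof.
case/sparityP; case: s => /= p1 p2; case: j => [[|[|[|[|//]]]] hj];
  rewrite /dd !(tnth_nth (@d1)) /=; apply/ffunP=> -[[] []];
  rewrite !ffunE /= ?expr1 ?expr0 ?scale1r ?scaleN1r;
  rewrite ?(mderivD, mderivB, mderivM, mderivN) ?p1 ?p2 ?mderiv0; ring.
Qed.

(* Two-sided ideal generated by G. *)
Definition ideal_gen (G : set P) : set P := fun p =>
  forall J : set P,
    J 0 -> (forall x y, J x -> J y -> J (x + y)) ->
    (forall x y, J y -> J (x * y)) -> (forall x y, J x -> J (x * y)) ->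
    G `<=` J -> J p.

Definition ideal (G : set P) : {pred P} := fun p => `[< ideal_gen G p >].

Fact ideal_submod_closed G : submod_closed (ideal G).
Proof.
split=> [|c x y /asboolP Ix /asboolP Iy]; apply/asboolP; first by move=> J.
move=> J J0 JD JMl JMr GJ; apply: (JD); last exact: Iy.
by rewrite -[x]mul1r scalerAl; apply: (JMl); apply: Ix.
Qed.

HB.instance Definition _ G :=
  GRing.isSubmodClosed.Build K P (ideal G) (ideal_submod_closed G).

End SuperPolynomials.

Section QuotientSpace.
Variables (K : comNzRingType) (G : set (spoly K)).

Definition squot : Type := Quotient.quot (ideal G).

HB.instance Definition _ := GRing.Zmodule.on squot.
HB.instance Definition _ : EqQuotient _ (Quotient.equiv (ideal G)) squot :=
  EqQuotient.on squot.
HB.instance Definition _ := isZmodQuotient.Build _ (Quotient.equiv (ideal G))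
  0 -%R +%R squot (lock _) (@Quotient.pi_opp _ (ideal G))
  (@Quotient.pi_add _ (ideal G)).

Definition spi (p : spoly K) : squot := \pi p.

Definition scaleq (c : K) (x : squot) : squot := spi (c *: repr x).

Fact spiD p q : spi (p + q) = spi p + spi q.
Proof. exact: (raddfD (\pi_squot)). Qed.

Fact spi_scale c p : spi (c *: p) = scaleq c (spi p).
Proof.
apply/eqP; rewrite /scaleq /spi -Quotient.idealrBE -scalerBr rpredZ //.
by rewrite Quotient.idealrBE reprK.
Qed.

Fact spiK (x : squot) : spi (repr x) = x.
Proof. exact: reprK. Qed.

Fact scaleqA c d x : scaleq c (scaleq d x) = scaleq (c * d) x.
Proof. by rewrite -[x]spiK -!spi_scale scalerA. Qed.

Fact scaleq1 : left_id 1 scaleq.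
Proof. by move=> x; rewrite -[x]spiK -spi_scale scale1r. Qed.

Fact scaleqDr : right_distributive scaleq +%R.
Proof.
by move=> c x y; rewrite -[x]spiK -[y]spiK -spiD -!spi_scale scalerDr spiD.
Qed.

Fact scaleqDl x : {morph scaleq^~ x : c d / c + d}.
Proof. by move=> c d; rewrite -[x]spiK -!spi_scale scalerDl spiD. Qed.

HB.instance Definition _ := GRing.Zmodule_isLmodule.Build K squot
  scaleqA scaleq1 scaleqDr scaleqDl.

(* The operator induced on the quotient by an operator preserving the ideal. *)
Definition qmap (f : spoly K -> spoly K) (x : squot) : squot := spi (f (repr x)).

Definition qparity (t : bool) (x : squot) :=
  exists2 p, sparity t p & x = spi p.

End QuotientSpace.

(* The real Jordan superalgebra D_alpha, in the basis e1, e2, xi, eta indexed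
   by 0, 1, 2, 3; endomorphisms are matrices acting on columns. *)
Section JordanSuperalgebra.
Variables (R : realType) (alpha : R).
Local Notation D := 'cV[R]_4.

Definition dbasis (i : 'I_4) : D := delta_mx i 0.
Definition jtable (i j : 'I_4) : D :=
  let e1 := dbasis 0 in let e2 := dbasis 1 in
  let hxi := 2^-1 *: dbasis 2 in let heta := 2^-1 *: dbasis 3 in
  let x := e1 + alpha *: e2 in
  nth 0 (nth [::] [::
    [:: e1;   0;    hxi; heta];
    [:: 0;    e2;   hxi; heta];
    [:: hxi;  hxi;  0;   x   ];
    [:: heta; heta; - x; 0   ]] i) j.

Definition jmul (a b : D) : D :=
  \sum_i \sum_j (a i 0 * b j 0) *: jtable i j.

Definition Lmx (a : D) : 'M[R]_4 := \matrix_(i, j) jmul a (dbasis j) i 0.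

Definition vparity (t : bool) (a : D) := forall i, dpar i != t -> a i 0 = 0.
Definition mxparity (t : bool) (T : 'M[R]_4) :=
  forall i j, dpar i (+) dpar j != t -> T i j = 0.

Definition hom_der (t : bool) (T : 'M[R]_4) :=
  mxparity t T /\
  forall (s : bool) (a b : D), vparity s a ->
    T *m jmul a b = jmul (T *m a) b + (-1) ^+ (t && s) *: jmul a (T *m b).

Definition Der (T : 'M[R]_4) :=
  exists T0 T1, [/\ hom_der false T0, hom_der true T1 & T = T0 + T1].

(* TKK(D_alpha) = D^- + ({L_a} + Der) + D^+ as a vector space: the record holds
   the components u^-, L_a, T and x^+ of an element. *)
Record tkk := Tkk {
  tminus : D;
  tL : D;
  tder : 'M[R]_4;
  tplus : D;
  tderP : Der tder
}.

Definition lie_g : set tkk := setT.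
Definition lie_k : set tkk := [set X | tL X = 0 /\ tplus X = - tminus X].
Definition lie_k0 : set tkk :=
  [set X | [/\ tL X = 0, tplus X = 0 & tminus X = 0]].

End JordanSuperalgebra.

Arguments lie_g {R} alpha _.
Arguments lie_k {R} alpha _.
Arguments lie_k0 {R} alpha _.

Section Fock.
Variables (R : realType) (alpha lam : R).
Local Notation D := 'cV[R]_4.
Local Notation C := R[i].
Local Notation P := (spoly C).
Local Notation z1 := (z1 C).
Local Notation z2 := (z2 C).
Local Notation z3 := (z3 C).
Local Notation z4 := (z4 C).
Implicit Types (p : P) (a : D) (T : 'M[R]_4).

Definition bessel1 p : P :=
  let q := d1 p in
  - lam%:C *: q + z1 * d1 q + z3 * d3 q + z4 * d4 q
  - (2 * alpha%:C) *: (z2 * d3 (d4 p)).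

Definition bessel2 p : P :=
  let q := d2 p in
  - (lam / alpha)%:C *: q + z2 * d2 q + z3 * d3 q + z4 * d4 q
  - 2 *: (z1 * d3 (d4 p)).

Definition bessel3 p : P :=
  let q := d4 p in
  - (2 * lam%:C) *: q + 2 *: (z1 * d1 q) + (2 * alpha%:C) *: (z2 * d2 q)
  + (2 * (1 + alpha%:C)) *: (z3 * d3 q) + z3 * d1 (d2 p).

Definition bessel4 p : P :=
  let q := d3 p in
  (2 * lam%:C) *: q - 2 *: (z1 * d1 q) - (2 * alpha%:C) *: (z2 * d2 q)
  - (2 * (1 + alpha%:C)) *: (z4 * d4 q) + z4 * d1 (d2 p).

Definition zD a : P := \sum_i (a i 0)%:C *: zz C i.

Definition besselD a p : P :=
  \sum_i (a i 0)%:C *: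
    tnth [tuple bessel1; bessel2; bessel3; bessel4] i p.

(* The superderivation z_b |-> z_(T b): see derT_zz, derT_leibniz. *)
Definition derT T p : P := \sum_j zD (T *m dbasis R j) * dd j p.

Fact dd_zz (i j : 'I_4) : dd j (zz C i) = (i == j)%:R.
Proof.
have -> : (i == j)%:R = if i == j then sone C else 0 by case: (i == j).
case: i => [[|[|[|[|//]]]] hi]; case: j => [[|[|[|[|//]]]] hj];
  rewrite /dd /zz !(tnth_nth (@d1 _)) !(tnth_nth 0) /=;
  apply/ffunP=> -[[] []]; rewrite !ffunE /= ?mderiv0 ?oppr0 //;
  rewrite -?mpolyC1 ?mderivC ?mderivX ?mnm1E /= ?scale0r ?scale1r //;
  by rewrite mulr1n mpolyC1 -mpolyX0; congr 'X_[_]; apply/mnmP=> k;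
     rewrite mnmBE subnn mnm0E.
Qed.

Fact mulmx_dbasis T i j : (T *m dbasis R j) i 0 = T i j.
Proof.
rewrite mxE (bigD1 j) //= mxE !eqxx mulr1 big1 ?addr0 // => k /negPf nkj.
by rewrite mxE nkj mulr0.
Qed.

Fact derT_zz T j : derT T (zz C j) = zD (T *m dbasis R j).
Proof.
rewrite /derT (bigD1 j) //= dd_zz eqxx mulr1 big1 ?addr0 // => k nkj.
by rewrite dd_zz eq_sym (negPf nkj) mulr0.
Qed.

Fact sparity_zD t T (j : 'I_4) : mxparity t T ->
  sparity (t (+) dpar j) (zD (T *m dbasis R j)).
Proof.
move=> hT u hu; rewrite sum_ffunE big1 // => i _; rewrite ffunE mulmx_dbasis.
have [hij|/hT->] := eqVneq (dpar i (+) dpar j) t; last by rewrite scale0r.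
move: hu; rewrite -hij -addbA addbb addbF.
case: i {hij} => [[|[|[|[|//]]]] hi]; rewrite /zz (tnth_nth 0) /=;
  by case: u => [[] []]; rewrite !ffunE ?scaler0.
Qed.

Fact derT_leibniz (t s : bool) T p q : mxparity t T -> sparity s p ->
  derT T (p * q) = derT T p * q + (-1) ^+ (t && s) *: (p * derT T q).
Proof.
move=> hT hp; rewrite /derT mulr_suml mulr_sumr scaler_sumr -big_split /=.
apply: eq_bigr => j _; rewrite (dd_leibniz _ _ hp) mulrDr mulrA; congr (_ + _).
rewrite -scalerAr !mulrA (smulC (sparity_zD (j := j) hT) hp).
rewrite -!scalerAl scalerA -signr_addb; congr ((-1) ^+ _ *: _).
by case: t s (dpar j) {hT hp} => [] [] [].
Qed.

(* The functional lambda on the L_a. *)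
Definition weight a : R := a 0 0 * (lam / 2) + a 1 0 * (lam / alpha / 2).

Definition piL a p : P := (weight a)%:C *: p - derT (Lmx alpha a) p.

Definition rho_minus a p : P :=
  - ('i / 2) *: (zD a * p + besselD a p) + 'i *: piL a p.
Definition rho_plus a p : P :=
  - ('i / 2) *: (zD a * p + besselD a p) - 'i *: piL a p.
Definition rho_L a p : P := 2^-1 *: (zD a * p - besselD a p).

Definition rho (X : tkk alpha) p : P :=
  rho_minus (tminus X) p + rho_L (tL X) p + derT (tder X) p
  + rho_plus (tplus X) p.

(* Here and below, the else branch is the case lam = 1. *)
Definition ideal_gens : set P :=
  if lam == alpha then
    [set` [:: 2 *: (z1 * z2) + z3 * z4; z2 ^+ 2; z2 * z3; z2 * z4]]
  else
    [set` [:: (2 * alpha%:C) *: (z1 * z2) + z3 * z4;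
              z1 ^+ 2; z1 * z3; z1 * z4]].

Definition Q : Type := squot ideal_gens.
HB.instance Definition _ := GRing.Lmodule.on Q.

Implicit Types (S : set (tkk alpha)) (U V W : set Q).

Definition pr p : Q := spi ideal_gens p.

Definition act (X : tkk alpha) : Q -> Q := qmap (rho X).

Definition subspace W :=
  W 0 /\ forall (c : C) (x y : Q), W x -> W y -> W (c *: x + y).

Definition span (G : set Q) : set Q :=
  [set v | forall W, subspace W -> G `<=` W -> W v].

Definition graded W := forall v, W v ->
  exists v0 v1 : Q,
    [/\ qparity false v0, qparity true v1, W v0, W v1 & v = v0 + v1].

(* Modules over a Lie superalgebra, and their submodules, are Z/2-graded. *)
Definition submodule S W :=
  [/\ subspace W, graded W & forall X v, S X -> W v -> W (act X v)].

Definition irreducible S W :=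
  [/\ submodule S W, W <> [set 0] &
      forall V, submodule S V -> V `<=` W -> V = [set 0] \/ V = W].

Definition direct_sum W U V :=
  [/\ W = [set v | exists x y : Q, [/\ U x, V y & v = x + y]] &
      U `&` V = [set 0]].

Definition indecomposable S W :=
  [/\ submodule S W, W <> [set 0] &
      forall U V, submodule S U -> submodule S V -> direct_sum W U V ->
        U = [set 0] \/ V = [set 0]].

Definition direct_sum_nat W (V : nat -> set Q) :=
  W = [set v | exists (n : nat) (x : nat -> Q),
                 (forall k, V k (x k)) /\ v = \sum_(k < n) x k] /\
  forall (n : nat) (x : nat -> Q), (forall k, V k (x k)) ->
    \sum_(k < n) x k = 0 -> forall k, (k < n)%N -> x k = 0.

(* U(g)1: the complex span of all X_1 ... X_n 1. *)
Definition Fock : set Q :=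
  span [set v | exists s : seq (tkk alpha), v = foldr act (pr 1) s].

Definition Fk (k : nat) : set Q :=
  if k is k'.+1 then
    let zi := if lam == alpha then z1 else z2 in
    span [set` [seq pr (z * zi ^+ k') | z <- [:: z1; z2; z3; z4]]]
  else span [set pr 1].

(* For k >= 1. *)
Definition Hk (k : nat) : set Q :=
  let: (w, zi) :=
    if lam == alpha then (z1 + (k%:R - 1 - alpha%:C) *: z2, z1)
    else (z2 + (k%:R - 1 - (alpha^-1)%:C) *: z1, z2) in
  span [set` [seq pr (z * zi ^+ k.-1) | z <- [:: w; z3; z4]]].

Definition line (k : nat) : set Q := span [set pr ((z1 + z2) ^+ k)].

End Fock.

Arguments Fock {R} alpha lam _.
Arguments Fk {R} alpha lam k _.
Arguments Hk {R} alpha lam k _.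
Arguments line {R} alpha lam k _.

(* Main.v *)
Require Import Defs.
From HB Require Import structures.
From mathcomp Require Import all_boot all_order all_algebra.
From mathcomp Require Import reals.
From mathcomp Require Import boolp classical_sets complex mpoly.
From mathcomp Require Import ring lra.

(** The two cases lam = alpha and lam = 1 are one computation. Let zp be the
    even variable whose powers survive in the quotient (z1, respectively z2),
    zs the other even variable, and put kap = 1, beta = alpha, respectively
    kap = alpha, beta = 1 / alpha. Modulo the ideal, zs^2, zs z3 and zs z4
    vanish and z3 z4 = - 2 kap zp zs, so every class has a unique representative
    f(zp) + g(zp) zs + h(zp) z3 + l(zp) z4 ([sub_lift_ideal], [part_lift]). The
    operators of the Fock representation become explicit differential operators
    on the quadruple (f, g, h, l), in which the two cases differ only
    by the values of kap and beta.

    In degree m + 1 a class is a vector (x, y, z, w) on the basis zp^(m+1),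
    zs zp^m, z3 zp^m, z4 zp^m. A derivation with odd parameters (s, t) sends it to
      2 kap (t z - s w) (zp^(m+1) + (m - beta) zs zp^m)
        + ((m + 1) x - y) (s z3 + t z4) zp^m
    plus the image of (z, w) under an element of sl2 ([der_qhom]). Hence odd vectors
    produce the harmonic vector (1, m - beta), and an even vector produces all
    odd ones unless it is proportional to (1, m + 1), that is, to (zp + zs)^(m+1)
    ([odd_to_harm], [even_to_odd]). The two even directions are different exactly
    when beta <> -1, that is, when alpha <> -1, and then they give the
    decomposition H + C (z1 + z2)^(m+1). When alpha = -1 they coincide, and this
    direction lies in every nonzero graded submodule, which excludes a direct
    sum while exhibiting a proper submodule ([submodule_harm]).

    Under k one also has L_e for e the idempotent of zp: it acts on zp^(m+1) and
    zs zp^m with different eigenvalues, so that the two components of an even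
    vector can be separated ([zp_term_in]). As m - beta <> 0, the harmonic
    vector and zp^(m+1) span the even part, and irreducibility follows.

    Under g one has multiplication by zp and the Bessel operator of zp. The
    latter lowers degrees, multiplying coefficients by j (j - 1 - beta) or
    j (j - beta); as beta is not a natural number it annihilates only
    quadruples of constants. So a nonzero submodule contains such a quadruple
    ([const_in]), then 1 ([one_in]), and from 1 the multiplication by zp and the
    odd derivations produce the whole quotient ([stable_full]). In particular
    F_lam is the whole quotient, and its decomposition is the grading by degree. *)

Set Implicit Arguments.
Unset Strict Implicit.
Unset Printing Implicit Defensive.

Import Order.TTheory GRing.Theory Num.Theory.
Local Open Scope ring_scope.
Local Open Scope complex_scope.
Local Open Scope quotient_scope.
Local Open Scope classical_set_scope.

(** * Coordinates modulo the ideal *)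

Lemma mpoly2_ind (K : comNzRingType) (P : {mpoly K[2]} -> Prop) :
  (forall c, P c%:MP) -> (forall p q, P p -> P q -> P (p + q)) ->
  (forall p, P p -> P ('X_0 * p)) -> (forall p, P p -> P ('X_1 * p)) ->
  forall p, P p.
Proof.
move=> PC PD P0 P1 p; elim/mpolyind: p => [|c m p _ _ Pp].
  by rewrite -mpolyC0; apply: PC.
apply: PD Pp; rewrite mpolyXE_id !big_ord_recl big_ord0 mulr1.
rewrite -mul_mpolyC mulrCA.
have -> : ord0 = 0 :> 'I_2 by [].
have -> : lift ord0 ord0 = 1 :> 'I_2 by apply/val_inj.
elim: (m 0) => [|n IHn]; last by rewrite exprS -mulrA; apply: P0.
rewrite expr0 mul1r mulrC.
by elim: (m 1) => [|n IHn]; [rewrite mul1r|rewrite exprS -mulrA; apply: P1].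
Qed.

Section Coordinates.
Variables (K : comNzRingType) (b : bool) (kap : K).
Implicit Types (p q : spoly K) (f g h l : {poly K}).

(** The boolean b tells whether z1 is the variable zp whose powers survive in
    the quotient; zs is the other even variable. *)
Definition pvar : 'I_2 := if b then 0 else 1.
Definition svar : 'I_2 := if b then 1 else 0.
Definition zp : spoly K := if b then z1 K else z2 K.
Definition zs : spoly K := if b then z2 K else z1 K.
Definition dp : spoly K -> spoly K := if b then @d1 K else @d2 K.
Definition ds : spoly K -> spoly K := if b then @d2 K else @d1 K.

(** Restriction to the line zs = 0, as a polynomial in zp. *)
Definition restr : {mpoly K[2]} -> {poly K} :=
  mmap (@polyC K) (fun k => if k == pvar then 'X else 0).
HB.instance Definition _ := GRing.RMorphism.on restr.

Lemma restrC c : restr c%:MP = c%:P.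
Proof. exact: mmapC. Qed.

Lemma restrZ c m : restr (c *: m) = c%:P * restr m.
Proof. exact: mmapZ. Qed.

Lemma restrXp : restr 'X_pvar = 'X.
Proof. by rewrite /restr mmapX mmap1U eqxx. Qed.

Lemma restrXs : restr 'X_svar = 0.
Proof. by rewrite /restr mmapX mmap1U /pvar /svar; case: b. Qed.

Lemma mderivXi (i j : 'I_2) : ('X_i : {mpoly K[2]})^`M(j) = (i == j)%:R.
Proof.
rewrite mderivX mnm1E; case: eqVneq => [->|_]; last by rewrite scale0r.
rewrite scale1r -mpolyX0; congr 'X_[_]; apply/mnmP=> k.
by rewrite mnmBE subnn mnm0E.
Qed.

Lemma restr_mderiv m : restr m^`M(pvar) = (restr m)^`().
Proof.
elim/mpoly2_ind: m => [c|m n IHm IHn|m IHm|m IHm].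
- by rewrite mderivC restrC rmorph0 derivC.
- by rewrite mderivD !rmorphD /= IHm IHn derivD.
- rewrite mderivM mderivXi rmorphD !rmorphM /= IHm derivM.
  congr (_ * _ + _); move: restrXp restrXs; rewrite /pvar /svar.
  by case: b => /= Xp Xs; rewrite ?Xp ?Xs ?rmorph1 ?rmorph0 ?derivX ?deriv0.
- rewrite mderivM mderivXi rmorphD !rmorphM /= IHm derivM.
  congr (_ * _ + _); move: restrXp restrXs; rewrite /pvar /svar.
  by case: b => /= Xp Xs; rewrite ?Xp ?Xs ?rmorph1 ?rmorph0 ?derivX ?deriv0.
Qed.

(** The coordinates of p modulo the ideal, on 1, zs, z3 and z4 over K[zp]. The
    zs-coordinate is the first-order term in zs, corrected by the z3 z4-component
    through z3 z4 = - 2 kap zp zs. *)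
Definition partp p := restr (p (false, false)).
Definition parts p :=
  locked (restr (p (false, false))^`M(svar)
          - (2 * kap)%:P * 'X * restr (p (true, true))).
Definition part3 p := restr (p (true, false)).
Definition part4 p := restr (p (false, true)).

Lemma partpM p q : partp (p * q) = partp p * partp q.
Proof. by rewrite /partp ffunE rmorphM. Qed.

(** The last term is the product of the odd parts, again rewritten with
    z3 z4 = - 2 kap zp zs; so the four coordinates together are multiplicative,
    and their common kernel is an ideal. *)
Lemma partsM p q : parts (p * q) =
  partp p * parts q + parts p * partp q
  - (2 * kap)%:P * 'X * (part3 p * part4 q - part4 p * part3 q).
Proof.
by rewrite /parts -!lock /partp /part3 /part4 !ffunE mderivM !rmorphE /=; ring.
Qed.

Lemma part3M p q : part3 (p * q) = partp p * part3 q + part3 p * partp q.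
Proof. by rewrite /part3 /partp ffunE rmorphD !rmorphM. Qed.

Lemma part4M p q : part4 (p * q) = partp p * part4 q + part4 p * partp q.
Proof. by rewrite /part4 /partp ffunE rmorphD !rmorphM. Qed.

Fact partp_is_linear : linear partp.
Proof. by move=> c p q; rewrite /partp !ffunE rmorphD /= restrZ mul_polyC. Qed.

Fact parts_is_linear : linear parts.
Proof.
move=> c p q; rewrite /parts -!lock !ffunE mderivD mderivZ !rmorphD /= !restrZ.
by rewrite -mul_polyC; ring.
Qed.

Fact part3_is_linear : linear part3.
Proof. by move=> c p q; rewrite /part3 !ffunE rmorphD /= restrZ mul_polyC. Qed.

Fact part4_is_linear : linear part4.
Proof. by move=> c p q; rewrite /part4 !ffunE rmorphD /= restrZ mul_polyC. Qed.

HB.instance Definition _ :=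
  GRing.isLinear.Build K (spoly K) {poly K} _ partp partp_is_linear.
HB.instance Definition _ :=
  GRing.isLinear.Build K (spoly K) {poly K} _ parts parts_is_linear.
HB.instance Definition _ :=
  GRing.isLinear.Build K (spoly K) {poly K} _ part3 part3_is_linear.
HB.instance Definition _ :=
  GRing.isLinear.Build K (spoly K) {poly K} _ part4 part4_is_linear.

Definition partM := (partpM, partsM, part3M, part4M).

Lemma part_one :
  (partp 1 = 1) * (parts 1 = 0) * (part3 1 = 0) * (part4 1 = 0).
Proof.
rewrite /partp /parts -!lock /part3 /part4 !ffunE /= mulr1n mulr0n !rmorph0.
by rewrite -mpolyC1 mderivC !rmorph0 restrC mulr0 subr0.
Qed.

Lemma part_zp :
  (partp zp = 'X) * (parts zp = 0) * (part3 zp = 0) * (part4 zp = 0).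
Proof.
rewrite /partp /parts -!lock /part3 /part4 /zp; move: restrXp; rewrite /pvar /svar.
by case: b => hX; rewrite !ffunE /= mderivXi !rmorph0 hX mulr0 subr0.
Qed.

Lemma part_zs :
  (partp zs = 0) * (parts zs = 1) * (part3 zs = 0) * (part4 zs = 0).
Proof.
rewrite /partp /parts -!lock /part3 /part4 /zs; move: restrXs; rewrite /pvar /svar.
by case: b => hX; rewrite !ffunE /= mderivXi !rmorph0 hX mulr0 subr0 ?rmorph1.
Qed.

Lemma part_z3 : (partp (z3 K) = 0) * (parts (z3 K) = 0)
  * (part3 (z3 K) = 1) * (part4 (z3 K) = 0).
Proof.
rewrite /partp /parts -!lock /part3 /part4 !ffunE /= mulr0n mulr1n.
by rewrite mderiv0 !rmorph0 rmorph1 mulr0 subr0.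
Qed.

Lemma part_z4 : (partp (z4 K) = 0) * (parts (z4 K) = 0)
  * (part3 (z4 K) = 0) * (part4 (z4 K) = 1).
Proof.
rewrite /partp /parts -!lock /part3 /part4 !ffunE /= mulr0n mulr1n.
by rewrite mderiv0 !rmorph0 rmorph1 mulr0 subr0.
Qed.

(** At kap = 1 and kap = alpha these are the generators of the two cases. *)
Definition gens : set (spoly K) :=
  [set` [:: (2 * kap) *: (z1 K * z2 K) + z3 K * z4 K;
            zs ^+ 2; zs * z3 K; zs * z4 K]].

Local Notation I := (ideal gens).

Lemma z12E : z1 K * z2 K = zp * zs.
Proof.
by rewrite /zp /zs; case: b => //; rewrite (@smulC _ false false) ?expr0 ?scale1r //;
   move=> [[] []]; rewrite ffunE.
Qed.

Lemma zp_central p : zp * p = p * zp.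
Proof.
by rewrite /zp; case: b; apply/ffunP => -[[] []]; rewrite !ffunE /=; ring.
Qed.

Lemma zs_central p : zs * p = p * zs.
Proof.
by rewrite /zs; case: b; apply/ffunP => -[[] []]; rewrite !ffunE /=; ring.
Qed.

Definition ev : {poly K} -> spoly K := locked (horner_alg zp).

Lemma evE f : ev f = horner_alg zp f.
Proof. by rewrite /ev -lock. Qed.

Lemma evX : ev 'X = zp. Proof. by rewrite evE horner_algX. Qed.
Lemma ev0 : ev 0 = 0. Proof. by rewrite evE rmorph0. Qed.
Lemma ev1 : ev 1 = 1. Proof. by rewrite evE rmorph1. Qed.
Lemma evD f g : ev (f + g) = ev f + ev g.
Proof. by rewrite !evE rmorphD. Qed.
Lemma evM f g : ev (f * g) = ev f * ev g.
Proof. by rewrite !evE rmorphM. Qed.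
Lemma evC c : ev c%:P = c *: 1.
Proof. by rewrite evE horner_algC. Qed.
Lemma evZ c f : ev (c *: f) = c *: ev f.
Proof. by rewrite -mul_polyC evM evC mulr_algl. Qed.

Lemma ev_comm f p : ev f * p = p * ev f.
Proof.
elim/poly_ind: f => [|f c IH]; first by rewrite ev0 mul0r mulr0.
rewrite evD evM evX evC mulrDl mulrDr -[_ * zp * p]mulrA zp_central mulrA IH.
by rewrite mulrA mulr_algl mulr_algr.
Qed.

Definition lift f g h l : spoly K :=
  ev f + ev g * zs + ev h * z3 K + ev l * z4 K.

Lemma ideal_part p : ideal_gen gens p ->
  [/\ partp p = 0, parts p = 0, part3 p = 0 & part4 p = 0].
Proof.
move/(_ [set p | [/\ partp p = 0, parts p = 0, part3 p = 0 & part4 p = 0]]).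
apply; first by rewrite /= !linear0.
- by move=> x y [x1 x2 x3 x4] [y1 y2 y3 y4]; split;
     rewrite linearD /= ?x1 ?x2 ?x3 ?x4 ?y1 ?y2 ?y3 ?y4 addr0.
- move=> x y [y1 y2 y3 y4]; split; rewrite partM y1 ?y2 ?y3 ?y4; ring.
- move=> x y [x1 x2 x3 x4]; split; rewrite partM x1 ?x2 ?x3 ?x4; ring.
move=> q; rewrite /gens /= !inE z12E => /or4P[]/eqP->;
  rewrite /= ?linearD ?linearZ /= ?expr2 !partM
  !(part_zp, part_zs, part_z3, part_z4) -?mul_polyC; split; ring.
Qed.

Lemma ideal_in p : ideal_gen gens p -> p \in I.
Proof. by move=> ?; apply/asboolP. Qed.

Lemma gens_in p : gens p -> p \in I.
Proof. by move=> Gp; apply: ideal_in => J _ _ _ _; apply. Qed.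

Lemma ideal_mull x y : y \in I -> x * y \in I.
Proof.
move/asboolP=> Iy; apply/asboolP=> J J0 JD Jl Jr GJ.
by apply: (Jl); apply: Iy.
Qed.

Lemma lift_linear c f g h l f' g' h' l' :
  lift (c *: f + f') (c *: g + g') (c *: h + h') (c *: l + l') =
  c *: lift f g h l + lift f' g' h' l'.
Proof.
have AC (V : nmodType) (u1 u2 v1 v2 w1 w2 x1 x2 : V) :
  (u1 + u2) + (v1 + v2) + (w1 + w2) + (x1 + x2) =
  (u1 + v1 + w1 + x1) + (u2 + v2 + w2 + x2).
  by rewrite (addrACA u1) (addrACA (u1 + v1)) addrACA.
rewrite /lift !evD !evZ !mulrDl -!scalerAl AC.
by rewrite -3!scalerDr.
Qed.

Let nf p := lift (partp p) (parts p) (part3 p) (part4 p).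

Lemma nf_linear c p q : nf (c *: p + q) = c *: nf p + nf q.
Proof. by rewrite /nf !linearP lift_linear. Qed.

Lemma gensP p : gens p <->
  [\/ p = (2 * kap) *: (z1 K * z2 K) + z3 K * z4 K,
      p = zs ^+ 2, p = zs * z3 K | p = zs * z4 K].
Proof.
rewrite /gens /= !inE; split; first by case/or4P=> /eqP; constructor.
by case=> ->; apply/or4P; [apply: Or41|apply: Or42|apply: Or43|apply: Or44];
   apply/eqP.
Qed.

Lemma zs_mul_ideal : [/\ zs * zs \in I, zs * z3 K \in I & zs * z4 K \in I].
Proof.
by split; apply/gens_in/gensP; [apply: Or42|apply: Or43|apply: Or44].
Qed.

Lemma z3z4_ideal : z3 K * z4 K + (2 * kap) *: (zp * zs) \in I.
Proof. by apply/gens_in/gensP/Or41; rewrite z12E addrC. Qed.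

Lemma z34_mul : [/\ z3 K * z3 K = 0, z4 K * z4 K = 0 & z4 K * z3 K = - (z3 K * z4 K)].
Proof. by split; apply/ffunP=> -[[] []]; rewrite !ffunE /=; ring. Qed.

Lemma mul_lift f g h l :
  [/\ zp * lift f g h l = lift ('X * f) ('X * g) ('X * h) ('X * l),
      zs * lift f g h l - lift 0 f 0 0 \in I,
      z3 K * lift f g h l - lift 0 (- (2 * kap)%:P * 'X * l) f 0 \in I &
      z4 K * lift f g h l - lift 0 ((2 * kap)%:P * 'X * h) 0 f \in I].
Proof.
case: zs_mul_ideal => Iss Is3 Is4; case: z34_mul => z33 z44 z43.
have Ez (c : K) n : ev (c%:P * 'X * n) * zs =
    ev n * (c *: (zp * zs)).
  rewrite !evM evC evX mulr_algl -scalerAr -!scalerAl.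
  by rewrite mulrA -(ev_comm _ zp).
have AC (x u v w : spoly K) : u + v + w - (x + u) = v + (w - x).
  by rewrite -(addrA u) (addrC x) opprD addrACA subrr add0r addrA.
have cm n q r : q * (ev n * r) = ev n * (q * r).
  by rewrite mulrA -ev_comm mulrA.
split.
- by rewrite /lift !evM evX !mulrDr !mulrA.
- rewrite /lift !ev0 !mul0r add0r !addr0 !mulrDr !cm -!(ev_comm _ zs).
  rewrite addrC !addrA addNr add0r.
  by rewrite !rpredD // ideal_mull.
- rewrite /lift !ev0 !mul0r add0r !addr0 !mulrDr !cm -!(ev_comm _ (z3 K)).
  rewrite z33 mulr0 addr0 -polyCN Ez.
  rewrite AC; apply: rpredD; first by rewrite -zs_central ideal_mull.
  by rewrite scaleNr mulrN opprK -mulrDr ideal_mull // z3z4_ideal.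
- rewrite /lift !ev0 !mul0r !add0r !addr0 !mulrDr !cm.
  rewrite -!(ev_comm _ (z4 K)) z44 mulr0 addr0 Ez AC.
  apply: rpredD; first by rewrite -zs_central ideal_mull.
  by rewrite z43 mulrN -opprD rpredN -mulrDr ideal_mull // z3z4_ideal.
Qed.

Lemma part_ev f :
  (partp (ev f) = f) * (parts (ev f) = 0)
  * (part3 (ev f) = 0) * (part4 (ev f) = 0).
Proof.
elim/poly_ind: f => [|f c IH]; first by rewrite ev0 !linear0.
rewrite evD evM evX evC !linearD !linearZ /= !partM.
by rewrite !IH !part_zp !part_one !scaler0 -mul_polyC; do !split; ring.
Qed.

Lemma part_lift f g h l :
  (partp (lift f g h l) = f) * (parts (lift f g h l) = g)
  * (part3 (lift f g h l) = h) * (part4 (lift f g h l) = l).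
Proof.
rewrite /lift !linearD /= !partM !part_ev !part_zs !part_z3 !part_z4.
by do !split; ring.
Qed.

Definition emb (m : {mpoly K[2]}) : spoly K :=
  [ffun u => if u == (false, false) then m else 0].

Lemma spoly_split p : p = emb (p (false, false)) + z3 K * emb (p (true, false))
  + z4 K * emb (p (false, true)) + z3 K * (z4 K * emb (p (true, true))).
Proof. by apply/ffunP => -[[] []]; rewrite !ffunE /=; ring. Qed.

(** The polynomials equal to their normal form modulo the ideal are stable under
    linear combinations and under multiplication by each variable ([mul_lift]),
    and they contain 1; hence they are all polynomials. *)
Lemma sub_lift_ideal p : p - nf p \in I.
Proof.
have nf0 : nf 0 = 0 by rewrite /nf !linear0 /lift !ev0 !mul0r !addr0.
have lin c q r : q - nf q \in I -> r - nf r \in I ->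
    c *: q + r - nf (c *: q + r) \in I.
  move=> Iq Ir; rewrite nf_linear opprD addrACA -scalerBr.
  exact: (rpredD (rpredZ c Iq) Ir).
have add q r : q - nf q \in I -> r - nf r \in I -> q + r - nf (q + r) \in I.
  by move=> Iq Ir; rewrite -[q]scale1r; apply: lin.
have mulz x q : x * nf q - nf (x * nf q) \in I -> q - nf q \in I ->
    x * q - nf (x * q) \in I.
  move=> Ix Iq; have <- : nf (x * nf q) = nf (x * q).
    by rewrite /nf !partM !part_lift.
  rewrite -(subrK (x * nf q) (x * q)) -addrA.
  by rewrite -mulrBr; apply: (rpredD (ideal_mull x Iq) Ix).
have Kz q : q - nf q \in I -> [/\ zp * q - nf (zp * q) \in I,
    zs * q - nf (zs * q) \in I, z3 K * q - nf (z3 K * q) \in I &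
    z4 K * q - nf (z4 K * q) \in I].
  have [h1 h2 h3 h4] := mul_lift (partp q) (parts q) (part3 q) (part4 q).
  move=> Iq; split; apply: mulz Iq.
  - by rewrite /nf h1 !part_lift subrr rpred0.
  - rewrite (_ : nf (zs * _) = lift 0 (partp q) 0 0); first exact: h2.
    by rewrite {1}/nf !partM !part_lift !part_zs; congr lift; ring.
  - rewrite (_ : nf (z3 K * _) = lift 0 (- (2 * kap)%:P * 'X * part4 q) (partp q) 0).
      exact: h3.
    by rewrite {1}/nf !partM !part_lift !part_z3; congr lift; ring.
  - rewrite (_ : nf (z4 K * _) = lift 0 ((2 * kap)%:P * 'X * part3 q) 0 (partp q)).
      exact: h4.
    by rewrite {1}/nf !partM !part_lift !part_z4; congr lift; ring.
have Kemb : forall m, emb m - nf (emb m) \in I.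
  have K1 : (1 : spoly K) - nf 1 \in I.
    rewrite /nf !part_one /lift !ev0 !mul0r !addr0 ev1 subrr rpred0 //.
  apply: mpoly2_ind => [c|m n Im In|m Im|m Im].
  - have -> : emb c%:MP = c *: 1 + 0.
      apply/ffunP=> -[[] []]; rewrite !ffunE /= ?scaler0 ?addr0 //.
      by rewrite -mul_mpolyC mulr1.
    by apply: (lin c 1 0); [exact: K1|rewrite nf0 subrr rpred0].
  - have -> : emb (m + n) = emb m + emb n; last exact: (add _ _ Im In).
    by apply/ffunP=> -[[] []]; rewrite !ffunE /= ?addr0.
  - have -> : emb ('X_0 * m) = (if b then zp else zs) * emb m.
      by rewrite /zp /zs; case: b; apply/ffunP=> -[[] []]; rewrite !ffunE /=; ring.
    by have [h0 h1 _ _] := Kz _ Im; case: b; [exact: h0|exact: h1].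
  - have -> : emb ('X_1 * m) = (if b then zs else zp) * emb m.
      by rewrite /zp /zs; case: b; apply/ffunP=> -[[] []]; rewrite !ffunE /=; ring.
    by have [h0 h1 _ _] := Kz _ Im; case: b; [exact: h1|exact: h0].
rewrite [p]spoly_split.
have [_ _ h3 _] := Kz _ (Kemb (p (true, false))).
have [_ _ _ h4] := Kz _ (Kemb (p (false, true))).
have [_ _ _ h] := Kz _ (Kemb (p (true, true))).
have [_ _ h34 _] := Kz _ h.
exact: (add _ _ (add _ _ (add _ _ (Kemb _) h3) h4) h34).
Qed.

(** * The operators in coordinates *)

(** These three parts of p are not determined by its coordinates. They occur in
    the derivatives of p, and cancel in the operators that preserve the ideal. *)
Definition part34 p : {poly K} := restr (p (true, true)).
Definition part3s p : {poly K} := restr (p (true, false))^`M(svar).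
Definition part4s p : {poly K} := restr (p (false, true))^`M(svar).

Lemma dpE p u : dp p u = (p u)^`M(pvar).
Proof. by rewrite /dp /pvar; case: b; rewrite ffunE. Qed.

Lemma dsE p u : ds p u = (p u)^`M(svar).
Proof. by rewrite /ds /svar; case: b; rewrite ffunE. Qed.

Lemma part_dp p :
  (partp (dp p) = (partp p)^`())
  * (parts (dp p) = (parts p)^`() + (2 * kap)%:P * part34 p)
  * (part3 (dp p) = (part3 p)^`()) * (part4 (dp p) = (part4 p)^`())
  * (part34 (dp p) = (part34 p)^`()).
Proof.
rewrite /partp /parts -?lock /part3 /part4 /part34 !dpE mderiv_comm !restr_mderiv.
by do !split; rewrite derivB !derivM derivC derivX; ring.
Qed.

Lemma part_ds p :
  (partp (ds p) = parts p + (2 * kap)%:P * 'X * part34 p)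
  * (part3 (ds p) = part3s p) * (part4 (ds p) = part4s p).
Proof.
by rewrite /partp /parts -?lock /part3 /part4 /part34 !dsE; do !split; ring.
Qed.

Lemma part_d3 p :
  (partp (d3 p) = part3 p) * (parts (d3 p) = part3s p)
  * (part3 (d3 p) = 0) * (part4 (d3 p) = part34 p) * (part34 (d3 p) = 0).
Proof.
rewrite /partp /parts -?lock /part3 /part4 /part34 /part3s !ffunE /= !rmorph0.
by rewrite mulr0 subr0.
Qed.

Lemma part_d4 p :
  (partp (d4 p) = part4 p) * (parts (d4 p) = part4s p)
  * (part3 (d4 p) = - part34 p) * (part4 (d4 p) = 0) * (part34 (d4 p) = 0).
Proof.
rewrite /partp /parts -?lock /part3 /part4 /part34 /part4s !ffunE /= !rmorph0.
by rewrite mulr0 subr0 rmorphN.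
Qed.

Definition partE := (partM, part_zp, part_zs, part_z3, part_z4).

(** Bessel operator of zp: in both cases it has this form, because
    2 alpha = 2 kap beta for z1 and 2 = 2 kap beta for z2. *)
Definition besselp (beta : K) p : spoly K :=
  let q := dp p in
  - beta *: q + zp * dp q + z3 K * d3 q + z4 K * d4 q
  - (2 * kap * beta) *: (zs * d3 (d4 p)).

(** The value (2 kap beta) of the coefficient of zs d3 d4 is the one for which
    the z3 z4-component of p drops out of the zs-coordinate. *)
Lemma part_besselp beta p :
  [/\ partp (besselp beta p) = 'X * (partp p)^`()^`() - beta%:P * (partp p)^`(),
      parts (besselp beta p) = 'X * (parts p)^`()^`() - beta%:P * (parts p)^`(),
      part3 (besselp beta p) =
        'X * (part3 p)^`()^`() + (1 - beta)%:P * (part3 p)^`() &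
      part4 (besselp beta p) =
        'X * (part4 p)^`()^`() + (1 - beta)%:P * (part4 p)^`()].
Proof.
rewrite /besselp; split; rewrite !(linearD, linearN, linearZ) /= -!mul_polyC !partE
  !(part_d3, part_d4, part_dp) ?derivD ?derivM ?derivC; ring.
Qed.

Definition zlin (t : 'cV[K]_4) : spoly K :=
  t 0 0 *: zp + t 1 0 *: zs + t 2 0 *: z3 K + t 3 0 *: z4 K.

Lemma part_zlin t :
  (partp (zlin t) = (t 0 0)%:P * 'X) * (parts (zlin t) = (t 1 0)%:P)
  * (part3 (zlin t) = (t 2 0)%:P) * (part4 (zlin t) = (t 3 0)%:P).
Proof.
rewrite /zlin 12!linearD /= !linearZ /= !partE -!mul_polyC.
by do !split; ring.
Qed.

(** Superderivation with z_j |-> sum_i T i j z_i, for the order zp, zs, z3, z4. *)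
Definition dermx (T : 'M[K]_4) p : spoly K :=
  zlin (col 0 T) * dp p + zlin (col 1 T) * ds p
  + zlin (col 2 T) * d3 p + zlin (col 3 T) * d4 p.

(** A superderivation given by T preserves the relations under these conditions:
    the first three come from zs^2, zs z4 and zs z3, the last one says that
    z3 z4 and zp zs have the same weight. *)
Definition ideal_stable (T : 'M[K]_4) :=
  [/\ T 0 1 = 0, T 0 3 = 2 * kap * T 2 1, T 0 2 = - (2 * kap * T 3 1) &
      T 3 3 = T 0 0 + T 1 1 - T 2 2].

Lemma part_dermx T p : ideal_stable T ->
  [/\ partp (dermx T p) = (T 0 0)%:P * 'X * (partp p)^`()
        + (T 0 2)%:P * 'X * part3 p + (T 0 3)%:P * 'X * part4 p,
      parts (dermx T p) = (T 0 0)%:P * 'X * (parts p)^`() + (T 1 1)%:P * parts p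
        + (T 1 0)%:P * (partp p)^`() + (T 1 2)%:P * part3 p + (T 1 3)%:P * part4 p
        + (2 * kap)%:P * 'X * ((T 3 0)%:P * (part3 p)^`() - (T 2 0)%:P * (part4 p)^`()),
      part3 (dermx T p) = (T 0 0)%:P * 'X * (part3 p)^`() + (T 2 0)%:P * (partp p)^`()
        + (T 2 1)%:P * parts p + (T 2 2)%:P * part3 p + (T 2 3)%:P * part4 p &
      part4 (dermx T p) = (T 0 0)%:P * 'X * (part4 p)^`() + (T 3 0)%:P * (partp p)^`()
        + (T 3 1)%:P * parts p + (T 3 2)%:P * part3 p + (T 3 3)%:P * part4 p].
Proof.
case=> h1 h2 h3 h4; rewrite /dermx.
by split; rewrite 3!linearD /= !partM !part_zlin !mxE h1 ?h2 ?h3 ?h4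
  !(part_d3, part_d4, part_dp, part_ds); ring.
Qed.

End Coordinates.

(** * Derivations of the Jordan superalgebra *)

Section Jordan.
Variables (R : realType) (alpha : R).
Implicit Types (x y : 'cV[R]_4) (T : 'M[R]_4).
Local Notation jmul := (jmul alpha).

Lemma big_ord4 (V : nmodType) (F : 'I_4 -> V) :
  \sum_i F i = F 0 + F 1 + F 2 + F 3.
Proof.
rewrite !big_ord_recr big_ord0 /= add0r.
by congr (F _ + F _ + F _ + F _); apply/val_inj.
Qed.

Lemma ord4_ind (P : 'I_4 -> Prop) : P 0 -> P 1 -> P 2 -> P 3 -> forall i, P i.
Proof.
move=> P0 P1 P2 P3 [[|[|[|[|//]]]] hi];
  [move: P0 | move: P1 | move: P2 | move: P3]; congr P; exact/val_inj.
Qed.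

Lemma jmulE x y :
  (jmul x y 0 0 = x 0 0 * y 0 0 + x 2 0 * y 3 0 - x 3 0 * y 2 0)
  * (jmul x y 1 0 = x 1 0 * y 1 0 + alpha * (x 2 0 * y 3 0 - x 3 0 * y 2 0))
  * (jmul x y 2 0 = 2^-1 * ((x 0 0 + x 1 0) * y 2 0 + x 2 0 * (y 0 0 + y 1 0)))
  * (jmul x y 3 0 = 2^-1 * ((x 0 0 + x 1 0) * y 3 0 + x 3 0 * (y 0 0 + y 1 0))).
Proof.
rewrite /jmul !big_ord4 /jtable /= !(scaler0, addr0, add0r).
by do !split; rewrite !mxE /=; ring.
Qed.

Lemma mulmxE T x i :
  (T *m x) i 0 = T i 0 * x 0 0 + T i 1 * x 1 0 + T i 2 * x 2 0 + T i 3 * x 3 0.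
Proof. by rewrite mxE big_ord4. Qed.

Lemma col4P x y : x 0 0 = y 0 0 -> x 1 0 = y 1 0 -> x 2 0 = y 2 0 ->
  x 3 0 = y 3 0 -> x = y.
Proof.
by move=> h0 h1 h2 h3; apply/matrixP=> i j; rewrite (ord1 j); elim/ord4_ind: i.
Qed.

(** The odd derivation with e1 |-> s xi + t eta and e2 |-> - (s xi + t eta); its
    values on xi and eta are forced by the Leibniz rule on e1 xi and e1 eta. *)
Definition odd_der (s t : R) : 'M[R]_4 := \matrix_(i, j)
  nth 0 (nth [::] [::
    [:: 0; 0; 2 * t; - (2 * s)];
    [:: 0; 0; - (2 * alpha * t); 2 * alpha * s];
    [:: s; - s; 0; 0];
    [:: t; - t; 0; 0]] i) j.

Lemma Der_odd_der s t : Der alpha (odd_der s t).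
Proof.
exists 0, (odd_der s t); split; last by rewrite add0r.
  split=> [i j _|u x y _]; first by rewrite mxE.
  have j0 z : jmul 0 z = 0 by apply: col4P; rewrite jmulE !mxE; ring.
  have j0' z : jmul z 0 = 0 by apply: col4P; rewrite jmulE !mxE; ring.
  by rewrite !mul0mx j0 j0' scaler0 addr0.
split=> [i j|u x y hx].
  by elim/ord4_ind: i; elim/ord4_ind: j; rewrite mxE.
have h0 := hx 0; have h1 := hx 1; have h2 := hx 2; have h3 := hx 3.
case: u {hx} h0 h1 h2 h3 => /= h0 h1 h2 h3.
  apply: col4P; rewrite mulmxE [RHS]mxE [X in _ = _ + X]mxE !jmulE
    !mulmxE !mxE /= expr1 (h0 isT) (h1 isT); by field.
apply: col4P; rewrite mulmxE [RHS]mxE [X in _ = _ + X]mxE !jmulE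
  !mulmxE !mxE /= expr0 (h2 isT) (h3 isT); by field.
Qed.

Lemma hom_der_basis t T : hom_der alpha t T -> forall i j k,
  (T *m jmul (dbasis R i) (dbasis R j)) k 0
  = jmul (T *m dbasis R i) (dbasis R j) k 0
    + (-1) ^+ (t && dpar i) * jmul (dbasis R i) (T *m dbasis R j) k 0.
Proof.
case=> _ hT i j k; rewrite (hT (dpar i)); first by rewrite mxE [X in _ + X]mxE.
move=> m hm; rewrite mxE eqxx andbT.
by case: (eqVneq m i) hm => [->|//]; rewrite eqxx.
Qed.

Lemma even_der_entries T : hom_der alpha false T ->
  [/\ T 0 0 = 0, T 1 1 = 0, T 0 1 = 0, T 1 0 = 0 & T 3 3 = - T 2 2].
Proof.
move=> hT; have E := hom_der_basis hT.
move: (E 0 0 0) (E 0 0 1) (E 1 1 0) (E 1 1 1) (E 2 3 0).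
rewrite !mulmxE !jmulE !mulmxE !mxE /= expr0.
move=> e1 e2 e3 e4 e5.
have t00 : T 0 0 = 0 by lra.
have t11 : T 1 1 = 0 by lra.
have t10 : T 1 0 = 0 by lra.
have t01 : T 0 1 = 0 by lra.
by split=> //; move: e5; rewrite t00 t01; lra.
Qed.

Lemma odd_der_entries T : hom_der alpha true T ->
  [/\ T 2 1 = - T 2 0, T 3 1 = - T 3 0,
      T 0 3 = - (2 * T 2 0) /\ T 1 3 = 2 * alpha * T 2 0 &
      T 0 2 = 2 * T 3 0 /\ T 1 2 = - (2 * alpha * T 3 0)].
Proof.
move=> hT; have E := hom_der_basis hT.
move: (E 0 1 2) (E 0 1 3) (E 0 2 0) (E 0 2 1) (E 0 3 0) (E 0 3 1).
rewrite !mulmxE !jmulE !mulmxE !mxE /= expr0.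
move=> e1 e2 e3 e4 e5 e6.
by split; [| |split|split]; lra.
Qed.

(** With an sl2 on xi and eta, the derivations [odd_der] are all: the Leibniz
    rule on e_i e_i kills the even block on e1, e2, the one on xi eta makes the
    block on xi, eta traceless, and the odd part is determined by e1. *)
Lemma Der_entries T : Der alpha T ->
  [/\ [/\ T 0 0 = 0, T 1 1 = 0, T 0 1 = 0 & T 1 0 = 0],
      [/\ T 2 1 = - T 2 0, T 3 1 = - T 3 0 & T 3 3 = - T 2 2],
      T 0 3 = - (2 * T 2 0) /\ T 1 3 = 2 * alpha * T 2 0 &
      T 0 2 = 2 * T 3 0 /\ T 1 2 = - (2 * alpha * T 3 0)].
Proof.
case=> T0 [T1 [h0 h1 ->]].
have [a1 a2 a3 a4 a5] := even_der_entries h0.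
have [b1 b2 [b3 b4] [b5 b6]] := odd_der_entries h1.
case: h0 h1 => p0 _ [p1 _].
have q0 i j : dpar i (+) dpar j -> T0 i j = 0 by move=> hij; apply: p0; rewrite hij.
have q1 i j : ~~ (dpar i (+) dpar j) -> T1 i j = 0.
  by move=> /negPf hij; apply: p1; rewrite hij.
split; [split|split|split|split]; rewrite !mxE.
- by rewrite a1 q1 // addr0.
- by rewrite a2 q1 // addr0.
- by rewrite a3 q1 // addr0.
- by rewrite a4 q1 // addr0.
- by rewrite !q0 // !add0r.
- by rewrite !q0 // !add0r.
- by rewrite a5 !q1 // !addr0.
- by rewrite !q0 // !add0r.
- by rewrite !q0 // !add0r.
- by rewrite !q0 // !add0r.
- by rewrite !q0 // !add0r.
Qed.

Lemma LmxE x : forall i j, Lmx alpha x i j = jmul x (dbasis R j) i 0.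
Proof. by move=> i j; rewrite mxE. Qed.

End Jordan.

(** * The Fock representation on k and on the raising and lowering operators *)

Section FockLinear.
Variables (R : realType) (alpha lam : R).
Local Notation C := R[i].
Implicit Types (p : spoly C) (a : 'cV[R]_4) (T : 'M[R]_4) (X : tkk alpha).
Local Notation weight := (weight alpha lam).
Local Notation besselD := (besselD alpha lam).

Lemma zDZ (c : R) a : zD (c *: a) = c%:C *: zD a.
Proof.
by rewrite /zD scaler_sumr; apply: eq_bigr => i _; rewrite mxE rmorphM scalerA.
Qed.

Lemma besselDZ (c : R) a p : besselD (c *: a) p = c%:C *: besselD a p.
Proof.
by rewrite /besselD scaler_sumr; apply: eq_bigr => i _; rewrite mxE rmorphM scalerA.
Qed.

Lemma jmulZ (c : R) a x : jmul alpha (c *: a) x = c *: jmul alpha a x.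
Proof. by apply: col4P; rewrite [RHS]mxE !jmulE !mxE; ring. Qed.

Lemma derTZ (c : R) T p : derT (c *: T) p = c%:C *: derT T p.
Proof.
rewrite /derT scaler_sumr; apply: eq_bigr => j _.
by rewrite -scalemxAl zDZ scalerAl.
Qed.

Lemma piLZ (c : R) a p : piL alpha lam (c *: a) p = c%:C *: piL alpha lam a p.
Proof.
have LZ : Lmx alpha (c *: a) = c *: Lmx alpha a.
  by apply/matrixP=> i j; rewrite [RHS]mxE !LmxE jmulZ mxE.
have WZ : weight (c *: a) = c * weight a by rewrite /weight !mxE; ring.
rewrite /piL LZ WZ derTZ.
move: (derT _ p) (weight a) => D w.
by rewrite scalerBr scalerA -rmorphM.
Qed.

Lemma rho_terms0 p : [/\ zD (0 : 'cV[R]_4) = 0, besselD 0 p = 0, piL alpha lam 0 p = 0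
  & derT (0 : 'M[R]_4) p = 0].
Proof.
split.
- by rewrite -(scale0r 0) zDZ scale0r.
- by rewrite -(scale0r 0) besselDZ scale0r.
- by rewrite -(scale0r 0) piLZ scale0r.
- by rewrite -(scale0r 0) derTZ scale0r.
Qed.

(** On a^- - a^+ the terms z_a and B(z_a) cancel, leaving only the operators
    pi(L_a), which preserve degrees. *)
Lemma rho_lie_k X p : lie_k alpha X -> rho lam X p =
  derT (tder X) p + (2 * 'i) *: piL alpha lam (tminus X) p.
Proof.
have AC (V : lmodType C) (S W D : V) (c d : C) :
    c *: S + d *: W + 2^-1 *: (0 - 0) + D + (c *: - S - d *: - W)
    = D + (2 * d) *: W.
  have -> : 2 * d = d + d by ring.
  rewrite subr0 scaler0 addr0 !scalerN opprK scalerDl.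
  move: (c *: S) (d *: W) => u w.
  by rewrite -(addrA u) (addrC u) addrA addrK (addrC w) -addrA.
case: X => a l T x TD [/= -> ->]; rewrite /rho /rho_L /rho_minus /rho_plus.
have [z0 b0 _ _] := rho_terms0 p; rewrite [tminus _]/= [tplus _]/= [tL _]/= [tder _]/=.
rewrite z0 b0 mul0r -[- a]scaleN1r zDZ besselDZ piLZ rmorphN1.
rewrite !(scaleN1r _) mulNr -opprD.
exact: AC.
Qed.

(** Conversely a^- + a^+ and L_a give z_a + B(z_a) and z_a - B(z_a), hence both
    z_a and B(z_a). *)
Lemma rho_raise_lower a (h0 : Der alpha 0) p :
  rho lam (Tkk a 0 a h0) p = - 'i *: (zD a * p + besselD a p) /\
  rho lam (Tkk 0 a 0 h0) p = 2^-1 *: (zD a * p - besselD a p).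
Proof.
have AC (V : lmodType C) (S W : V) (c d : C) :
    c *: S + d *: W + 2^-1 *: (0 - 0) + 0 + (c *: S - d *: W) = (c + c) *: S.
  rewrite subr0 scaler0 !addr0 scalerDl.
  move: (c *: S) (d *: W) => u w.
  by rewrite (addrC u) -addrA (addrC w) addrA subrK.
have AC' (V : lmodType C) (S : V) (c d : C) :
    c *: (0 + 0) + d *: 0 + S + 0 + (c *: (0 + 0) - d *: 0) = S.
  by rewrite !addr0 !scaler0 subr0 !addr0 add0r.
have [z0 b0 p0 d0] := rho_terms0 p.
split; rewrite /rho /rho_L /rho_minus /rho_plus
  [tminus _]/= [tplus _]/= [tL _]/= [tder _]/=.
  rewrite z0 b0 d0 mul0r AC; congr (_ *: _); by field.
by rewrite z0 b0 d0 p0 mul0r AC'.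
Qed.

End FockLinear.

(** * Coordinates on the quotient *)

Section FockQuotient.
Variables (R : realType) (alpha : R) (b : bool).
Hypotheses (alpha0 : alpha != 0) (alpha1 : alpha != 1).
Local Notation C := R[i].
Local Notation lam := (if b then alpha else 1).
Local Notation kap := ((if b then 1 else alpha)%:C).
Local Notation beta := ((if b then alpha else alpha^-1)%:C).
Hypothesis betaN : forall n : nat, n%:R != beta :> C.

Local Notation Q := (Q alpha lam).
Local Notation pr := (@pr R alpha lam).
Local Notation span := (@Defs.span R alpha lam).
Local Notation Fock := (Fock alpha lam).
Local Notation zp := (zp C b).
Local Notation zs := (zs C b).
Local Notation partp := (@partp C b).
Local Notation parts := (@parts C b kap).
Local Notation part3 := (@part3 C b).
Local Notation part4 := (@part4 C b).
Local Notation lift := (@lift C b).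
Implicit Types (p q : spoly C) (f g h l : {poly C}) (u v : Q).
Implicit Types (V W G : set Q) (c x y z w : C) (m n : nat).
Implicit Types (X : tkk alpha) (a : 'cV[R]_4) (A : 'M[R]_4) (T : 'M[C]_4).

Lemma ideal_gensE : ideal_gens alpha lam = gens b kap.
Proof.
rewrite /ideal_gens /gens /zs; case: b; first by rewrite eqxx mulr1.
by rewrite eq_sym (negPf alpha1).
Qed.

(** The class with given coordinates, made abstract so that it is known only
    through its coordinates. *)
Fact qlift_key : {qlift : {poly C} -> {poly C} -> {poly C} -> {poly C} -> Q |
  forall f g h l, qlift f g h l = pr (lift f g h l)}.
Proof. by exists (fun f g h l => pr (lift f g h l)). Qed.

Definition qlift := sval qlift_key.

Lemma qliftE f g h l : qlift f g h l = pr (lift f g h l).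
Proof. exact: (svalP qlift_key). Qed.

Definition qp v : {poly C} := partp (repr v).
Definition qs v : {poly C} := parts (repr v).
Definition q3 v : {poly C} := part3 (repr v).
Definition q4 v : {poly C} := part4 (repr v).

Lemma pr_eq p q : pr p = pr q <-> p - q \in ideal (gens b kap).
Proof.
rewrite -ideal_gensE; split=> [/eqP|h]; first by rewrite -Quotient.idealrBE.
by apply/eqP; rewrite -Quotient.idealrBE.
Qed.

Lemma prD p q : pr (p + q) = pr p + pr q.
Proof. exact: spiD. Qed.

Lemma prZ c p : pr (c *: p) = c *: pr p.
Proof. exact: spi_scale. Qed.

Lemma pr_qlift p : pr p = qlift (partp p) (parts p) (part3 p) (part4 p).
Proof. by rewrite qliftE; apply/pr_eq/sub_lift_ideal. Qed.

Lemma part_eq p q : pr p = pr q ->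
  [/\ partp p = partp q, parts p = parts q, part3 p = part3 q & part4 p = part4 q].
Proof.
move/pr_eq/asboolP/ideal_part; rewrite !linearB /= => -[h1 h2 h3 h4].
by split; apply/eqP; rewrite -subr_eq0 ?h1 ?h2 ?h3 ?h4.
Qed.

Lemma q_pr p :
  (qp (pr p) = partp p) * (qs (pr p) = parts p) * (q3 (pr p) = part3 p)
  * (q4 (pr p) = part4 p).
Proof. by have [] := part_eq (spiK (pr p)). Qed.

Lemma q_qlift f g h l :
  (qp (qlift f g h l) = f) * (qs (qlift f g h l) = g) * (q3 (qlift f g h l) = h)
  * (q4 (qlift f g h l) = l).
Proof. by rewrite qliftE !q_pr !part_lift. Qed.

Lemma qlift_eta v : v = qlift (qp v) (qs v) (q3 v) (q4 v).
Proof. by rewrite -pr_qlift; apply/esym/spiK. Qed.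

Lemma qlift_linear c f g h l f' g' h' l' :
  c *: qlift f g h l + qlift f' g' h' l' =
  qlift (c *: f + f') (c *: g + g') (c *: h + h') (c *: l + l').
Proof.
by rewrite !qliftE lift_linear -prZ -prD.
Qed.

Lemma qliftD f g h l f' g' h' l' :
  qlift f g h l + qlift f' g' h' l' = qlift (f + f') (g + g') (h + h') (l + l').
Proof. by rewrite -[qlift f g h l]scale1r qlift_linear !scale1r. Qed.

Lemma qlift0 : qlift 0 0 0 0 = 0.
Proof. by apply: (addrI (qlift 0 0 0 0)); rewrite qliftD !addr0. Qed.

Lemma qliftZ c f g h l : c *: qlift f g h l = qlift (c *: f) (c *: g) (c *: h) (c *: l).
Proof. by rewrite -[LHS]addr0 -qlift0 qlift_linear !addr0. Qed.

Lemma q_linear c u v :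
  (qp (c *: u + v) = c *: qp u + qp v) * (qs (c *: u + v) = c *: qs u + qs v)
  * (q3 (c *: u + v) = c *: q3 u + q3 v) * (q4 (c *: u + v) = c *: q4 u + q4 v).
Proof. by rewrite {1 3 5 7}[u]qlift_eta {1 3 5 7}[v]qlift_eta qlift_linear !q_qlift. Qed.

Lemma qlift_inj f g h l f' g' h' l' : qlift f g h l = qlift f' g' h' l' ->
  [/\ f = f', g = g', h = h' & l = l'].
Proof.
move=> e; have := (congr1 qp e, congr1 qs e, congr1 q3 e, congr1 q4 e).
by rewrite !q_qlift => {e} -[[[-> ->] ->] ->].
Qed.

(** A class of given parity has a homogeneous representative, whose coordinates
    of the other parity vanish; conversely, removing from a representative its
    components of the wrong parity does not change the coordinates. *)
Lemma qparityP t v : qparity t v <->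
  if t then qp v = 0 /\ qs v = 0 else q3 v = 0 /\ q4 v = 0.
Proof.
split=> [[p hp ->]|h].
  case: t hp => hp; rewrite !q_pr ?/partp ?/parts -?lock ?/part3 ?/part4 !hp //.
    by rewrite mderiv0 !rmorph0 mulr0 subr0.
  by rewrite !rmorph0.
pose p : spoly C := [ffun u => if u.1 (+) u.2 != t then 0 else (repr v : spoly C) u].
exists p; first by move=> u hu; rewrite ffunE hu.
have -> : spi (ideal_gens alpha lam) p = pr p by [].
rewrite pr_qlift [LHS]qlift_eta; move: h; rewrite /qp /qs /q3 /q4.
rewrite /partp /parts -?lock /part3 /part4 !ffunE.
by case: t {p} => -[-> ->] /=; rewrite ?mderiv0 ?rmorph0 ?mulr0 ?subr0.
Qed.

(** * The action of k, of zp and of its Bessel operator *)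

(** The order (zp, zs, z3, z4) of the variables. *)
Definition swap01 (i : 'I_4) : 'I_4 := if b then i else tnth [tuple 1; 0; 2; 3] i.

Local Notation e1 := (dbasis R (swap01 0)).

Definition framed A : 'M[C]_4 := \matrix_(i, j) (A (swap01 i) (swap01 j))%:C.

Lemma sum_swap01 (V : nmodType) (F : 'I_4 -> V) :
  \sum_i F i = F (swap01 0) + F (swap01 1) + F (swap01 2) + F (swap01 3).
Proof.
rewrite big_ord4 /swap01; case: b; rewrite // !(tnth_nth 0) /=.
by rewrite [X in X + _ + _ = _]addrC.
Qed.

Lemma zz_swap01 : (zz C (swap01 0) = zp) * (zz C (swap01 1) = zs)
  * (zz C (swap01 2) = z3 C) * (zz C (swap01 3) = z4 C).
Proof.
by rewrite /zz /swap01 /zp /zs; case: b; do !split; rewrite !(tnth_nth 0).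
Qed.

Lemma dd_swap01 : (@dd C (swap01 0) = @dp C b) * (@dd C (swap01 1) = @ds C b)
  * (@dd C (swap01 2) = @d3 C) * (@dd C (swap01 3) = @d4 C).
Proof.
by rewrite /dd /swap01 /dp /ds; case: b; do !split;
   rewrite ?(tnth_nth (@d1 C)) ?(tnth_nth 0).
Qed.

Lemma zD_framed a : zD a = zlin b (\col_i (a (swap01 i) 0)%:C).
Proof. by rewrite /zD sum_swap01 !zz_swap01 /zlin !mxE. Qed.

Lemma derT_framed A p : derT A p = dermx b (framed A) p.
Proof.
have Z j : zD (A *m dbasis R (swap01 j)) = zlin b (col j (framed A)).
  rewrite zD_framed; congr zlin; apply/matrixP=> i k.
  by rewrite [LHS]mxE mulmx_dbasis mxE mxE.
by rewrite /derT sum_swap01 !dd_swap01 /dermx !Z.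
Qed.

Lemma zD_primary : zD (dbasis R (swap01 0)) = zp.
Proof.
rewrite zD_framed /zlin !mxE /swap01.
by case: b; rewrite /= !scale0r !addr0 scale1r.
Qed.

Lemma besselD_primary p :
  besselD alpha lam (dbasis R (swap01 0)) p = besselp b kap beta p.
Proof.
have aE i : dbasis R (swap01 0) (swap01 i) 0 = (i == 0)%:R.
  rewrite mxE eqxx andbT /swap01; case: b => //.
  by elim/ord4_ind: i; rewrite !(tnth_nth 0).
rewrite /besselD sum_swap01 !aE /= !scale0r !addr0 scale1r /swap01.
have E : 2 * alpha%:C * (alpha^-1)%:C = 2.
  by rewrite -mulrA -rmorphM divff // mulr1.
case: b; first by rewrite /bessel1 /besselp mulr1.
rewrite (tnth_nth (@bessel1 R alpha 1)) (tnth_nth 0) [nth _ _ _]/=.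
by rewrite /bessel2 /besselp /dp /zp /zs E div1r.
Qed.

(** In the order (zp, zs, z3, z4) the derivations have the same shape in both
    cases, with the constants kap and beta. *)
Lemma framed_der A : Der alpha A -> exists (s t u v w : C),
  framed A = \matrix_(i, j) nth 0 (nth [::] [::
    [:: 0; 0; 2 * kap * t; - (2 * kap * s)];
    [:: 0; 0; - (2 * kap * beta * t); 2 * kap * beta * s];
    [:: s; - s; u; v];
    [:: t; - t; w; - u]] i) j.
Proof.
move=> /Der_entries[[e00 e11 e01 e10] [e21 e31 e33] [e03 e13] [e02 e12]].
exists (framed A 2 0), (framed A 3 0), (A 2 2)%:C, (A 2 3)%:C, (A 3 2)%:C.
apply/matrixP=> i j; rewrite !mxE /swap01.
elim/ord4_ind: i; elim/ord4_ind: j; case: b;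
  rewrite ?(tnth_nth 0) /= ?e00 ?e11 ?e01 ?e10 ?e21 ?e31 ?e33 ?e03 ?e13 ?e02 ?e12
    ?rmorphE //=; try (by field; rewrite ?fmorph_eq0).
Qed.

(** The sign e: an odd derivation takes opposite values on e1 and e2. *)
Lemma framed_odd_der s t : let e : R := if b then 1 else -1 in
  framed (odd_der alpha (e * s) (e * t)) = \matrix_(i, j) nth 0 (nth [::] [::
    [:: 0; 0; 2 * kap * t%:C; - (2 * kap * s%:C)];
    [:: 0; 0; - (2 * kap * beta * t%:C); 2 * kap * beta * s%:C];
    [:: s%:C; - s%:C; 0; 0];
    [:: t%:C; - t%:C; 0; 0]] i) j.
Proof.
move=> e; apply/matrixP=> i j; rewrite !mxE /swap01 /e.
elim/ord4_ind: i; elim/ord4_ind: j; case: b;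
  rewrite ?(tnth_nth 0) /= ?rmorphE //=; try (by field; rewrite ?fmorph_eq0).
Qed.

Lemma framed_L a : exists x y z w,
  framed (Lmx alpha a) = \matrix_(i, j) nth 0 (nth [::] [::
    [:: x; 0; - (kap * w); kap * z];
    [:: 0; y; - (kap * beta * w); kap * beta * z];
    [:: z / 2; z / 2; (x + y) / 2; 0];
    [:: w / 2; w / 2; 0; (x + y) / 2]] i) j.
Proof.
exists (a (swap01 0) 0)%:C, (a (swap01 1) 0)%:C, (a 2 0)%:C, (a 3 0)%:C.
apply/matrixP=> i j; rewrite !mxE -/(Lmx alpha a) /swap01.
elim/ord4_ind: i; elim/ord4_ind: j; case: b;
  rewrite ?(tnth_nth 0) /= !jmulE !mxE /= ?rmorphE //=; try (by field; rewrite ?fmorph_eq0).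
Qed.

Lemma framed_L_primary :
  framed (Lmx alpha (dbasis R (swap01 0))) = \matrix_(i, j) nth 0 (nth [::] [::
    [:: 1; 0; 0; 0];
    [:: 0; 0; 0; 0];
    [:: 0; 0; 2^-1; 0];
    [:: 0; 0; 0; 2^-1]] i) j.
Proof.
apply/matrixP=> i j; rewrite !mxE -/(Lmx alpha _) /swap01.
elim/ord4_ind: i; elim/ord4_ind: j; case: b;
  rewrite ?(tnth_nth 0) /= !jmulE !mxE /= ?rmorphE //=; try (by field; rewrite ?fmorph_eq0).
Qed.

(** The operators of [part_dermx], [part_besselp] and the multiplication by zp,
    on the quotient. *)
Definition qder T v : Q :=
  qlift (T 0 0 *: ('X * (qp v)^`()) + T 0 2 *: ('X * q3 v) + T 0 3 *: ('X * q4 v))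
     (T 0 0 *: ('X * (qs v)^`()) + T 1 1 *: qs v + T 1 0 *: (qp v)^`()
      + T 1 2 *: q3 v + T 1 3 *: q4 v
      + (2 * kap) *: (T 3 0 *: ('X * (q3 v)^`()) - T 2 0 *: ('X * (q4 v)^`())))
     (T 0 0 *: ('X * (q3 v)^`()) + T 2 0 *: (qp v)^`() + T 2 1 *: qs v
      + T 2 2 *: q3 v + T 2 3 *: q4 v)
     (T 0 0 *: ('X * (q4 v)^`()) + T 3 0 *: (qp v)^`() + T 3 1 *: qs v
      + T 3 2 *: q3 v + T 3 3 *: q4 v).

Lemma pr_dermx T v : ideal_stable kap T -> pr (dermx b T (repr v)) = qder T v.
Proof.
move=> hT; rewrite pr_qlift.
have [-> -> -> ->] := part_dermx b (repr v) hT.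
rewrite /qder /qp /qs /q3 /q4.
move: (partp _) (parts _) (part3 _) (part4 _) => f g h l.
by congr qlift; rewrite -!mul_polyC; ring.
Qed.

Lemma framed_der_stable (T : 'M[R]_4) : Der alpha T -> ideal_stable kap (framed T).
Proof.
move=> /framed_der[s [t [u [v [w ->]]]]].
by split; rewrite !mxE /=; ring.
Qed.

Lemma framed_L_stable (a : 'cV[R]_4) : ideal_stable kap (framed (Lmx alpha a)).
Proof.
have [x [y [z [w ->]]]] := framed_L a.
by split; rewrite !mxE /=; field.
Qed.

Lemma act_lie_k X v : lie_k alpha X -> act X v =
  qder (framed (tder X)) v + (2 * 'i) *: ((weight alpha lam (tminus X))%:C *: v
    - qder (framed (Lmx alpha (tminus X))) v).
Proof.
move=> hX; have -> : act X v = pr (rho lam X (repr v)) by [].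
have E1 : pr (derT (tder X) (repr v)) = qder (framed (tder X)) v.
  rewrite derT_framed; apply/pr_dermx/framed_der_stable.
  by case: X {hX}.
have E2 : pr (derT (Lmx alpha (tminus X)) (repr v))
    = qder (framed (Lmx alpha (tminus X))) v.
  by rewrite derT_framed; apply/pr_dermx/framed_L_stable.
have E3 : pr (repr v) = v by exact: spiK.
have E p q r c d : pr (p + c *: (d *: q - r)) = pr p + c *: (d *: pr q - pr r).
  by rewrite prD prZ prD -scaleN1r !prZ scaleN1r.
rewrite (rho_lie_k _ _ hX) /piL.
apply: (etrans (E _ _ _ _ _)).
exact: (f_equal2 +%R E1 (f_equal2 (fun u v => _ *: (_ *: u - v)) E3 E2)).
Qed.

Definition qmul_zp v : Q := qlift ('X * qp v) ('X * qs v) ('X * q3 v) ('X * q4 v).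

Definition bessel_poly (c : C) f : {poly C} := 'X * f^`()^`() + c *: f^`().

Definition qbessel v : Q := qlift
  (bessel_poly (- beta) (qp v)) (bessel_poly (- beta) (qs v))
  (bessel_poly (1 - beta) (q3 v)) (bessel_poly (1 - beta) (q4 v)).

Lemma Der0 : Der alpha 0.
Proof.
by have := Der_odd_der alpha 0 0; congr Der; apply/matrixP=> i j; rewrite !mxE;
  elim/ord4_ind: i; elim/ord4_ind: j; rewrite /= ?mulr0 ?oppr0.
Qed.

Lemma act_raise_lower v :
  act (Tkk e1 0 e1 Der0) v = - 'i *: (qmul_zp v + qbessel v) /\
  act (Tkk 0 e1 0 Der0) v = 2^-1 *: (qmul_zp v - qbessel v).
Proof.
have prZB : pr (zp * repr v) = qmul_zp v
    /\ pr (besselp b kap beta (repr v)) = qbessel v.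
  rewrite !pr_qlift /qmul_zp /qbessel /qp /qs /q3 /q4; split.
    rewrite !(partM b kap) !(part_zp b kap).
    move: (partp _) (parts _) (part3 _) (part4 _) => f g h l.
    by congr qlift; ring.
  have [-> -> -> ->] := part_besselp b kap beta (repr v).
  move: (partp _) (parts _) (part3 _) (part4 _) => f g h l.
  by congr qlift; rewrite /bessel_poly -mul_polyC ?polyCN ?mulNr.
have ED p q c : pr (c *: (p + q)) = c *: (pr p + pr q) by rewrite prZ prD.
have EB p q c : pr (c *: (p - q)) = c *: (pr p - pr q).
  by rewrite prZ prD -scaleN1r prZ scaleN1r.
have [rA rB] := rho_raise_lower lam e1 Der0 (repr v).
rewrite zD_primary besselD_primary in rA rB.
case: prZB => EZ EL; split.
  apply: (etrans (congr1 pr rA)); apply: (etrans (ED _ _ _)).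
  exact: (f_equal2 (fun u v => _ *: (u + v)) EZ EL).
apply: (etrans (congr1 pr rB)); apply: (etrans (EB _ _ _)).
exact: (f_equal2 (fun u v => _ *: (u - v)) EZ EL).
Qed.

Lemma q_op_linear c u v :
  (forall T, qder T (c *: u + v) = c *: qder T u + qder T v) /\
  qmul_zp (c *: u + v) = c *: qmul_zp u + qmul_zp v /\
  qbessel (c *: u + v) = c *: qbessel u + qbessel v.
Proof.
have [[[E1 E2] E3] E4] := q_linear c u v.
split=> [T|]; [|split]; rewrite /qder /qmul_zp /qbessel E1 E2 E3 E4;
  move: (qp u) (qs u) (q3 u) (q4 u) => f g h l;
  move: (qp v) (qs v) (q3 v) (q4 v) => f' g' h' l'; rewrite qlift_linear;
  by congr qlift; rewrite /bessel_poly ?derivD ?derivZ -!mul_polyC; ring.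
Qed.

(** The vector (x, y, z, w) on the basis zp^(m+1), zs zp^m, z3 zp^m, z4 zp^m. *)
Definition qhom (m : nat) (x y z w : C) : Q :=
  qlift (x *: 'X^(m.+1)) (y *: 'X^m) (z *: 'X^m) (w *: 'X^m).

Lemma X_derivXn m : 'X * ('X^m)^`() = m%:R%:P * 'X^m :> {poly C}.
Proof.
case: m => [|m]; first by rewrite derivXn mulr0n mulr0 mul0r.
by rewrite derivXn /= -mulr_natl mulrCA -exprS polyC_natr.
Qed.

Lemma qder_qhom T m x y z w : qder T (qhom m x y z w) = qhom m
  (m.+1%:R * T 0 0 * x + T 0 2 * z + T 0 3 * w)
  (m%:R * T 0 0 * y + T 1 1 * y + m.+1%:R * T 1 0 * x + T 1 2 * z + T 1 3 * w
   + 2 * kap * m%:R * (T 3 0 * z - T 2 0 * w))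
  (m%:R * T 0 0 * z + m.+1%:R * T 2 0 * x + T 2 1 * y + T 2 2 * z + T 2 3 * w)
  (m%:R * T 0 0 * w + m.+1%:R * T 3 0 * x + T 3 1 * y + T 3 2 * z + T 3 3 * w).
Proof.
have XD (c : C) n : 'X * (c *: 'X^n)^`() = (c * n%:R) *: 'X^n :> {poly C}.
  by rewrite derivZ -scalerAr X_derivXn mul_polyC scalerA.
have D (c : C) : (c *: 'X^(m.+1))^`() = (m.+1%:R * c) *: 'X^m :> {poly C}.
  by rewrite derivZ derivXn -scaler_nat scalerA mulrC.
rewrite /qder /qhom !q_qlift !XD !D.
by congr qlift; rewrite -!mul_polyC ?exprS; ring.
Qed.

(** * The subspaces F_k, H_k and C (z1 + z2)^k in coordinates *)

Lemma subspaceD V u v : subspace V -> V u -> V v -> V (u + v).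
Proof. by case=> _ VD Vu Vv; rewrite -[u]scale1r; apply: VD. Qed.

Lemma subspaceZ V c v : subspace V -> V v -> V (c *: v).
Proof. by case=> V0 VD Vv; rewrite -[_ *: _]addr0; apply: VD. Qed.

Lemma subspaceZI V c v : subspace V -> c != 0 -> V (c *: v) -> V v.
Proof. by move=> sV c0 /(subspaceZ c^-1 sV); rewrite scalerA mulVf // scale1r. Qed.

Lemma span_subspace G : subspace (span G).
Proof.
split=> [W [] //|c u v Su Sv W sW GW].
by case: (sW) => _; apply; [apply: Su|apply: Sv].
Qed.

Lemma span_gen G : G `<=` span G.
Proof. by move=> v Gv W _; apply. Qed.

Lemma neq_set0 V : subspace V -> V <> [set 0] -> exists2 v, V v & v <> 0.
Proof.
move=> [V0 _] nV; apply: contrapT => h; apply: nV; apply/seteqP; split=> v.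
  by move=> Vv /=; apply: contrapT => nv; apply: h; exists v.
by move=> ->.
Qed.

Lemma qhom_linear c m x y z w x' y' z' w' :
  c *: qhom m x y z w + qhom m x' y' z' w' =
  qhom m (c * x + x') (c * y + y') (c * z + z') (c * w + w').
Proof. by rewrite /qhom qlift_linear !scalerA -!scalerDl. Qed.

Lemma qhomD m x y z w x' y' z' w' : qhom m x y z w + qhom m x' y' z' w' =
  qhom m (x + x') (y + y') (z + z') (w + w').
Proof. by rewrite -[X in X + _]scale1r qhom_linear !mul1r. Qed.

Lemma qhom0 m : qhom m 0 0 0 0 = 0.
Proof. by rewrite /qhom !scale0r qlift0. Qed.

Lemma qhomZ c m x y z w : c *: qhom m x y z w = qhom m (c * x) (c * y) (c * z) (c * w).
Proof. by rewrite -[LHS]addr0 -(qhom0 m) qhom_linear !addr0. Qed.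

Lemma qhom_inj m x y z w x' y' z' w' : qhom m x y z w = qhom m x' y' z' w' ->
  [/\ x = x', y = y', z = z' & w = w'].
Proof.
move=> /qlift_inj[]; have XI n (c d : C) : c *: 'X^n = d *: 'X^n -> c = d.
  by move=> /(congr1 (fun p : {poly C} => p`_n)); rewrite !coefZ coefXn eqxx !mulr1.
by move=> /XI-> /XI-> /XI-> /XI->.
Qed.

Lemma qlift_eq0 f g h l : qlift f g h l = 0 -> [/\ f = 0, g = 0, h = 0 & l = 0].
Proof. by rewrite -qlift0 => /qlift_inj. Qed.

Lemma qhom_eq0 m x y z w : qhom m x y z w = 0 -> [/\ x = 0, y = 0, z = 0 & w = 0].
Proof. by rewrite -(qhom0 m) => /qhom_inj. Qed.

Definition evenq v : Q := qlift (qp v) (qs v) 0 0.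
Definition oddq v : Q := qlift 0 0 (q3 v) (q4 v).

Lemma gradedP W : graded W <-> forall v, W v -> W (evenq v) /\ W (oddq v).
Proof.
split=> [gW v Wv|h v Wv].
  have [v0 [v1 [/qparityP[a3 a4] /qparityP[b1 b2] W0 W1 ->]]] := gW v Wv.
  have [[[E1 E2] E3] E4] := q_linear 1 v0 v1.
  rewrite scale1r in E1 E2 E3 E4.
  rewrite /evenq /oddq E1 E2 E3 E4 !scale1r a3 a4 b1 b2 !addr0 !add0r.
  rewrite -{1}a3 -{1}a4 -{1}b1 -{1}b2.
  by rewrite -!qlift_eta.
have [We Wo] := h v Wv; exists (evenq v), (oddq v); split=> //.
- by apply/qparityP; rewrite /evenq !q_qlift.
- by apply/qparityP; rewrite /oddq !q_qlift.
- by rewrite /evenq /oddq qliftD !addr0 !add0r -qlift_eta.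
Qed.

Lemma evenq_qhom m x y z w : evenq (qhom m x y z w) = qhom m x y 0 0.
Proof. by rewrite /evenq !q_qlift /qhom !scale0r. Qed.

Lemma oddq_qhom m x y z w : oddq (qhom m x y z w) = qhom m 0 0 z w.
Proof. by rewrite /oddq !q_qlift /qhom !scale0r. Qed.

Lemma lamE : (lam == alpha) = b.
Proof. by case: b; rewrite ?eqxx // eq_sym (negPf alpha1). Qed.

Lemma part_zpXn m :
  (partp (zp ^+ m) = 'X^m) * (parts (zp ^+ m) = 0)
  * (part3 (zp ^+ m) = 0) * (part4 (zp ^+ m) = 0).
Proof.
elim: m => [|m [[[E1 E2] E3] E4]]; first by rewrite !expr0 !(part_one b kap).
rewrite !exprS !(partM b kap) E1 E2 E3 E4 !(part_zp b kap).
by do !split; ring.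
Qed.

Lemma pr_basis m :
  [/\ pr (zp * zp ^+ m) = qhom m 1 0 0 0, pr (zs * zp ^+ m) = qhom m 0 1 0 0,
      pr (z3 C * zp ^+ m) = qhom m 0 0 1 0 & pr (z4 C * zp ^+ m) = qhom m 0 0 0 1].
Proof.
have [[[E1 E2] E3] E4] := part_zpXn m.
split; rewrite pr_qlift !(partM b kap) E1 E2 E3 E4
  ?(part_zp b kap) ?(part_zs b kap) ?(part_z3 b kap) ?(part_z4 b kap)
  /qhom exprS !scale0r scale1r; congr qlift; ring.
Qed.

Lemma pr_one : pr 1 = qlift 1 0 0 0.
Proof. by rewrite pr_qlift !(part_one b kap). Qed.

Definition qhoms m : set Q := [set v | exists x y z w, v = qhom m x y z w].

Lemma qhoms_subspace m : subspace (qhoms m).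
Proof.
split; first by exists 0, 0, 0, 0; rewrite qhom0.
move=> c _ _ [x [y [z [w ->]]]] [x' [y' [z' [w' ->]]]].
by rewrite qhom_linear; do 4!eexists.
Qed.

Lemma qhom_in V m x y z w : subspace V -> V (qhom m 1 0 0 0) -> V (qhom m 0 1 0 0) ->
  V (qhom m 0 0 1 0) -> V (qhom m 0 0 0 1) -> V (qhom m x y z w).
Proof.
move=> sV V1 V2 V3 V4.
have -> : qhom m x y z w = x *: qhom m 1 0 0 0 + (y *: qhom m 0 1 0 0
    + (z *: qhom m 0 0 1 0 + w *: qhom m 0 0 0 1)).
  by rewrite !qhomZ !qhomD !(mulr0, mulr1, addr0, add0r).
by do ![apply: subspaceD => //]; apply: subspaceZ.
Qed.

Lemma generatorsE :
  [:: z1 C; z2 C; z3 C; z4 C] = [:: zp; zs; z3 C; z4 C]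
  \/ [:: z1 C; z2 C; z3 C; z4 C] = [:: zs; zp; z3 C; z4 C].
Proof. by rewrite /zp /zs; case: b; [left|right]. Qed.

Lemma mem_seq4 (T : eqType) (r s t u v : T) :
  v \in [:: r; s; t; u] <-> [\/ v = r, v = s, v = t | v = u].
Proof.
rewrite !in_cons in_nil orbF; split; first by case/or4P=> /eqP ->; constructor.
by case=> ->; rewrite eqxx ?orbT.
Qed.

Lemma FkS m : Fk alpha lam m.+1 = qhoms m.
Proof.
rewrite /Fk lamE; have [P1 P2 P3 P4] := pr_basis m.
set s := [seq _ | _ <- _].
have hs : forall v, v \in s <-> [\/ v = qhom m 1 0 0 0, v = qhom m 0 1 0 0,
    v = qhom m 0 0 1 0 | v = qhom m 0 0 0 1].
  move=> v; rewrite /s -/zp -P1 -P2 -P3 -P4.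
  case: generatorsE => ->; rewrite mem_seq4; first by [].
  by split; case=> ->; [apply: Or42|apply: Or41|apply: Or43|apply: Or44
                       |apply: Or42|apply: Or41|apply: Or43|apply: Or44].
apply/seteqP; split=> v.
  apply; first exact: qhoms_subspace.
  by move=> u /hs[]->; do 4!eexists.
move=> [x [y [z [w ->]]]].
by apply: (qhom_in _ _ _ _ (span_subspace _)); apply: span_gen; apply/hs;
  [apply: Or41|apply: Or42|apply: Or43|apply: Or44].
Qed.

Lemma Fk0 : Fk alpha lam 0 = [set v | exists c, v = qlift c%:P 0 0 0].
Proof.
have -> : Fk alpha lam 0 = span [set pr 1] by [].
rewrite pr_one; apply/seteqP; split=> v.
  apply; last by move=> u ->; exists 1.
  split; first by exists 0; rewrite qlift0.
  by move=> c _ _ [x ->] [y ->]; exists (c * x + y);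
     rewrite qlift_linear !scaler0 !addr0 polyCD polyCM mul_polyC.
move=> [c ->].
have -> : qlift c%:P 0 0 0 = c *: qlift 1 0 0 0 by rewrite qliftZ !scaler0 alg_polyC.
by apply: (subspaceZ _ (span_subspace _)); apply: span_gen.
Qed.

(** Slope of the harmonic line: the even part of H_(m+1) is spanned by
    zp^(m+1) + (m - beta) zs zp^m. *)
Definition harm_coef m : C := m%:R - beta.

Lemma HkS m : Hk alpha lam m.+1 =
  [set v | exists x z w, v = qhom m x (harm_coef m * x) z w].
Proof.
rewrite /Hk lamE.
set s := (X in let: (w, zi) := X in _).
have [P1 P2 P3 P4] := pr_basis m.
have sE : s = (zp + harm_coef m *: zs, zp).
  rewrite /s /harm_coef /zp /zs; case: b; rewrite -natr1 addrK //.
rewrite {}sE /=.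
have Pw : pr ((zp + harm_coef m *: zs) * zp ^+ m) = qhom m 1 (harm_coef m) 0 0.
  by rewrite mulrDl -scalerAl prD prZ P1 P2 qhomZ qhomD !(mulr0, mulr1, addr0, add0r).
rewrite Pw P3 P4; apply/seteqP; split=> v.
  apply.
    split; first by exists 0, 0, 0; rewrite mulr0 qhom0.
    move=> c _ _ [x [z [w ->]]] [x' [z' [w' ->]]].
    exists (c * x + x'), (c * z + z'), (c * w + w'); rewrite qhom_linear.
    by congr qhom; ring.
  move=> u; rewrite /= !in_cons in_nil orbF => /or3P[]/eqP->.
  - by exists 1, 0, 0; rewrite mulr1.
  - by exists 0, 1, 0; rewrite mulr0.
  - by exists 0, 0, 1; rewrite mulr0.
move=> [x [z [w ->]]].
have -> : qhom m x (harm_coef m * x) z w = x *: qhom m 1 (harm_coef m) 0 0 +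
    (z *: qhom m 0 0 1 0 + w *: qhom m 0 0 0 1).
  by rewrite !qhomZ !qhomD !(mulr0, mulr1, addr0, add0r) mulrC.
have sD := subspaceD (span_subspace _); have sZ := subspaceZ _ (span_subspace _).
by apply: (sD); [|apply: (sD)]; apply: (sZ); apply: span_gen;
  rewrite /= !in_cons in_nil eqxx ?orbT.
Qed.

Lemma lineS m : line alpha lam m.+1 = [set v | exists x, v = qhom m x (m.+1%:R * x) 0 0].
Proof.
have zE : z1 C + z2 C = zp + zs by rewrite /zp /zs; case: b; rewrite // addrC.
have PE : pr ((z1 C + z2 C) ^+ m.+1) = qhom m 1 m.+1%:R 0 0.
  rewrite zE; have E n : (partp ((zp + zs) ^+ n.+1) = 'X^(n.+1))
      * (parts ((zp + zs) ^+ n.+1) = n.+1%:R%:P * 'X^n)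
      * (part3 ((zp + zs) ^+ n.+1) = 0) * (part4 ((zp + zs) ^+ n.+1) = 0).
    elim: n => [|n [[[E1 E2] E3] E4]].
      by rewrite !expr1 !linearD /= !(part_zp b kap) !(part_zs b kap) expr0;
         do !split; ring.
    rewrite (exprS (zp + zs) n.+1) !(partM b kap) E1 E2 E3 E4 !linearD /=.
    rewrite !(part_zp b kap) !(part_zs b kap) -[n.+2%:R]natr1 polyCD !exprS.
    by do !split; ring.
  rewrite pr_qlift !E /qhom !scale0r scale1r mul_polyC //.
have -> : line alpha lam m.+1 = span [set pr ((z1 C + z2 C) ^+ m.+1)] by [].
rewrite PE; apply/seteqP; split=> v.
  apply; last by move=> u ->; exists 1; rewrite mulr1.
  split; first by exists 0; rewrite mulr0 qhom0.
  move=> c _ _ [x ->] [y ->]; exists (c * x + y); rewrite qhom_linear.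
  by congr qhom; ring.
move=> [x ->].
have -> : qhom m x (m.+1%:R * x) 0 0 = x *: qhom m 1 m.+1%:R 0 0.
  by rewrite qhomZ !(mulr0, mulr1) mulrC.
by apply: (subspaceZ _ (span_subspace _)); apply: span_gen.
Qed.

(** * Modules over k0 and k *)

Lemma kap_neq0 : kap != 0.
Proof. by rewrite fmorph_eq0; case: b; rewrite ?oner_eq0. Qed.

Lemma beta_neqN1 : alpha != -1 -> 1 + beta != 0.
Proof.
move=> an1; rewrite -rmorphD /= fmorph_eq0 addrC addr_eq0; move: (b) => -[] //.
by rewrite -(inj_eq (@invr_inj _)) invrK invrN invr1.
Qed.

Lemma harm_coef_neq0 m : harm_coef m != 0.
Proof. by rewrite subr_eq0 betaN. Qed.

Lemma qder0 v : qder 0 v = 0.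
Proof.
have e i j : (0 : 'M[C]_4) i j = 0 by rewrite mxE.
rewrite -qlift0 /qder; move: (qp v) (qs v) (q3 v) (q4 v) => f g h l.
by rewrite !e !scale0r !addr0 subr0 scaler0 addr0.
Qed.

Lemma framed0 : framed 0 = 0.
Proof. by apply/matrixP=> i j; rewrite !mxE. Qed.

Lemma act_lie_k0 X v : lie_k0 alpha X -> act X v = qder (framed (tder X)) v.
Proof.
move=> [XL Xp Xm]; rewrite act_lie_k; last first.
  by split; rewrite // Xp Xm oppr0.
have L0 : Lmx alpha 0 = 0.
  by apply/matrixP=> i j; rewrite LmxE; elim/ord4_ind: i; rewrite jmulE !mxE; ring.
have w0 : weight alpha lam 0 = 0 by rewrite /weight !mxE !mul0r addr0.
by rewrite Xm w0 L0 framed0 qder0 scale0r subr0 scaler0 addr0.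
Qed.

Lemma lie_k0_k X : lie_k0 alpha X -> lie_k alpha X.
Proof. by move=> [XL Xp Xm]; split; rewrite // Xp Xm oppr0. Qed.

(** The central formula: a derivation maps odd vectors to harmonic ones, and sees
    an even vector (x, y) only through (m + 1) x - y, its defect from being
    proportional to (zp + zs)^(m+1). *)
Lemma der_qhom X m x y z w : lie_k0 alpha X -> exists (s t p q r : C),
  act X (qhom m x y z w) = qhom m
    (2 * kap * (t * z - s * w)) (harm_coef m * (2 * kap * (t * z - s * w)))
    (s * (m.+1%:R * x - y) + p * z + q * w)
    (t * (m.+1%:R * x - y) + r * z - p * w).
Proof.
move=> hX; rewrite (act_lie_k0 _ hX).
have [s [t [p [q [r ->]]]]] := framed_der (tderP X).
exists s, t, p, q, r; rewrite qder_qhom /harm_coef.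
by congr qhom; rewrite !mxE /=; ring.
Qed.

(** The sign e normalises z_p |-> s z3 + t z4 in both cases. *)
Definition tkk_der (s t : R) : tkk alpha :=
  let e := if b then 1 else -1 in Tkk 0 0 0 (Der_odd_der alpha (e * s) (e * t)).

Lemma tkk_der_k0 s t : lie_k0 alpha (tkk_der s t).
Proof. by []. Qed.

Lemma act_tkk_der s t m x y z w : act (tkk_der s t) (qhom m x y z w) = qhom m
  (2 * kap * (t%:C * z - s%:C * w)) (harm_coef m * (2 * kap * (t%:C * z - s%:C * w)))
  (s%:C * (m.+1%:R * x - y)) (t%:C * (m.+1%:R * x - y)).
Proof.
rewrite (act_lie_k0 _ (tkk_der_k0 s t)) (framed_odd_der s t) qder_qhom.
by rewrite /harm_coef; congr qhom; rewrite !mxE /=; ring.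
Qed.

Definition tkk_L : tkk alpha := Tkk e1 0 (- e1) Der0.

(** The derivation of L_e has eigenvalue m + 1 on zp^(m+1) and m on zs zp^m, so
    subtracting m isolates the first term. *)
Lemma zp_term_in V m x y : subspace V ->
  (forall X v, lie_k alpha X -> V v -> V (act X v)) ->
  V (qhom m x y 0 0) -> V (qhom m x 0 0 0).
Proof.
move=> sV kV Vv; have hX : lie_k alpha tkk_L by [].
have := kV _ _ hX Vv; rewrite (act_lie_k _ hX) /= framed0 qder0 add0r.
rewrite framed_L_primary qder_qhom.
have i0 : 2 * 'i != 0 :> C.
  by rewrite mulf_neq0 ?pnatr_eq0 // eq_complex /= oner_eq0 andbF.
move/(subspaceZI sV i0); set c := (weight alpha lam e1)%:C => h.
have := subspaceD sV h (subspaceZ (m%:R - c) sV Vv).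
have N1 : -1 != 0 :> C by rewrite oppr_eq0 oner_eq0.
rewrite -scaleN1r !qhomZ !qhomD => h1; apply: (subspaceZI sV N1).
by congr V: h1; rewrite qhomZ; congr qhom; rewrite !mxE /=; ring.
Qed.

Section StableUnderDerivations.
Variables (V : set Q) (m : nat).
Hypotheses (sV : subspace V) (gV : graded V).
Hypothesis kV : forall s t v, V v -> V (act (tkk_der s t) v).

Lemma even_in x y z w : V (qhom m x y z w) -> V (qhom m x y 0 0).
Proof.
by move=> Vv; have [+ _] := (gradedP V).1 gV _ Vv; rewrite evenq_qhom.
Qed.

Lemma odd_in x y z w : V (qhom m x y z w) -> V (qhom m 0 0 z w).
Proof.
by move=> Vv; have [_ +] := (gradedP V).1 gV _ Vv; rewrite oddq_qhom.
Qed.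

Lemma odd_to_harm z w : V (qhom m 0 0 z w) -> (z, w) <> (0, 0) ->
  V (qhom m 1 (harm_coef m) 0 0).
Proof.
move=> Vv zw.
have k2 : 2 * kap != 0 by rewrite mulf_neq0 ?pnatr_eq0 ?kap_neq0.
have key s t : V ((2 * kap * (t%:C * z - s%:C * w)) *: qhom m 1 (harm_coef m) 0 0).
  have := kV s t Vv; rewrite act_tkk_der qhomZ.
  by rewrite !(mulr0, mulr1, subr0, mul0r) [_ * harm_coef m]mulrC.
have [z0|z0] := eqVneq z 0; last first.
  apply: (subspaceZI sV _ (key 0 1)).
  by rewrite mulf_neq0 // mul0r subr0 mul1r.
apply: (subspaceZI sV _ (key 1 0)).
rewrite mulf_neq0 // mul0r sub0r mul1r oppr_eq0; apply/eqP => w0.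
by apply: zw; rewrite z0 w0.
Qed.

Lemma even_to_odd x y : V (qhom m x y 0 0) -> m.+1%:R * x != y ->
  V (qhom m 0 0 1 0) /\ V (qhom m 0 0 0 1).
Proof.
rewrite -subr_eq0 => Vv xy.
have key s t : V ((m.+1%:R * x - y) *: qhom m 0 0 s%:C t%:C).
  have := kV s t Vv; rewrite act_tkk_der qhomZ.
  by rewrite !(mulr0, subr0) ![_ * (_ - y)]mulrC.
by split; [have := key 1 0|have := key 0 1]; exact: subspaceZI.
Qed.

End StableUnderDerivations.

Lemma tkk_der_stable (S : set (tkk alpha)) V : lie_k0 alpha `<=` S -> submodule S V ->
  forall s t v, V v -> V (act (tkk_der s t) v).
Proof. by move=> kS [_ _ SV] s t v; apply: SV; apply/kS/tkk_der_k0. Qed.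

Lemma irreducible_intro (S : set (tkk alpha)) W : submodule S W ->
  (exists2 v, W v & v <> 0) ->
  (forall V v, submodule S V -> V `<=` W -> V v -> v <> 0 -> W `<=` V) ->
  irreducible S W.
Proof.
move=> sW [v Wv nv] h; split=> //; first by move=> W0; apply: nv; move: Wv; rewrite W0.
move=> V sV VW; have [->|/(neq_set0 _)[]] := pselect (V = [set 0]); first by left.
  by case: sV.
by move=> u Vu nu; right; apply/seteqP; split=> //; apply: h nu.
Qed.

Lemma submodule_k0 W : submodule (lie_k alpha) W -> submodule (lie_k0 alpha) W.
Proof. by case=> sW gW kW; split=> // X v /lie_k0_k; apply: kW. Qed.

Lemma Fk_submodule k : submodule (lie_k alpha) (Fk alpha lam k).
Proof.
case: k => [|m].
  rewrite Fk0; split.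
  - split; first by exists 0; rewrite qlift0.
    by move=> c _ _ [x ->] [y ->]; exists (c * x + y);
       rewrite qlift_linear !scaler0 !addr0 polyCD polyCM mul_polyC.
  - apply/gradedP=> _ [c ->]; rewrite /evenq /oddq !q_qlift.
    by split; [exists c|exists 0].
  - move=> X _ hX [c ->]; rewrite (act_lie_k _ hX).
    have Z T : qder T (qlift c%:P 0 0 0) = 0.
      by rewrite /qder !q_qlift derivC deriv0 !(mulr0, scaler0, addr0, subr0) qlift0.
    rewrite !Z add0r subr0 !qliftZ !scaler0 -!mul_polyC -!polyCM.
    by eexists.
rewrite FkS; split; first exact: qhoms_subspace.
  apply/gradedP=> _ [x [y [z [w ->]]]]; rewrite evenq_qhom oddq_qhom.
  by split; do 4!eexists.
move=> X _ hX [x [y [z [w ->]]]]; rewrite (act_lie_k _ hX).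
have sH := qhoms_subspace m.
have h T : qhoms m (qder T (qhom m x y z w)).
  by rewrite qder_qhom; do 4!eexists.
apply: (subspaceD sH (h _)); apply: (subspaceZ _ sH).
rewrite -[- qder _ _]scaleN1r; apply: (subspaceD sH); apply: (subspaceZ _ sH) => //.
by do 4!eexists.
Qed.

Lemma Hk_submodule m : submodule (lie_k0 alpha) (Hk alpha lam m.+1).
Proof.
rewrite HkS; split.
- split; first by exists 0, 0, 0; rewrite mulr0 qhom0.
  move=> c _ _ [x [z [w ->]]] [x' [z' [w' ->]]].
  exists (c * x + x'), (c * z + z'), (c * w + w'); rewrite qhom_linear.
  by congr qhom; ring.
- apply/gradedP=> _ [x [z [w ->]]]; rewrite evenq_qhom oddq_qhom.
  by split; [exists x, 0, 0|exists 0, z, w]; rewrite ?mulr0.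
move=> X _ hX [x [z [w ->]]].
have [s [t [p [q [r ->]]]]] := der_qhom m x (harm_coef m * x) z w hX.
by do 3!eexists.
Qed.

Lemma line_submodule m : submodule (lie_k0 alpha) (line alpha lam m.+1).
Proof.
rewrite lineS; split.
- split; first by exists 0; rewrite mulr0 qhom0.
  move=> c _ _ [x ->] [x' ->]; exists (c * x + x'); rewrite qhom_linear.
  by congr qhom; ring.
- apply/gradedP=> _ [x ->]; rewrite evenq_qhom oddq_qhom.
  by split; [exists x|exists 0]; rewrite ?mulr0.
move=> X _ hX [x ->].
have [s [t [p [q [r ->]]]]] := der_qhom m x (m.+1%:R * x) 0 0 hX.
by exists 0; congr qhom; ring.
Qed.

(** The defect of the harmonic vector is (m + 1) - (m - beta) = 1 + beta, so from
    it one reaches all odd vectors, and from any odd vector one comes back. *)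
Lemma Hk_irreducible m : alpha != -1 -> irreducible (lie_k0 alpha) (Hk alpha lam m.+1).
Proof.
move=> /beta_neqN1 b1.
apply: irreducible_intro; first exact: Hk_submodule.
  exists (qhom m 0 0 1 0); first by rewrite HkS; exists 0, 1, 0; rewrite mulr0.
  by move=> /qhom_eq0[_ _ /eqP]; rewrite oner_eq0.
move=> V v mV VH Vv nv; rewrite HkS in VH *.
have [sV gV _] := mV; have kV := tkk_der_stable (@subset_refl _ _) mV.
have [x [z [w vE]]] := VH _ Vv; rewrite {}vE in Vv nv.
have Vo := odd_in gV Vv; have Ve := even_in gV Vv.
have [Vh Vodd] : V (qhom m 1 (harm_coef m) 0 0) /\
   (V (qhom m 0 0 1 0) /\ V (qhom m 0 0 0 1)).
  have he x' : x' != 0 -> m.+1%:R * x' != harm_coef m * x'.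
    move=> x'0; rewrite -subr_eq0 -mulrBl mulf_neq0 // /harm_coef -natr1.
    by move: b1; congr (_ != 0); ring.
  have [x0|x0] := eqVneq x 0.
    have Vh : V (qhom m 1 (harm_coef m) 0 0).
      apply: (odd_to_harm sV kV Vo) => -[z0 w0].
      by apply: nv; rewrite x0 z0 w0 mulr0 qhom0.
    split=> //; apply: (even_to_odd sV kV Vh).
    by rewrite -[harm_coef m]mulr1 he ?oner_eq0.
  split; last by apply: (even_to_odd sV kV Ve); apply: he.
  apply: (subspaceZI sV x0); move: Ve; congr V.
  by rewrite qhomZ; congr qhom; ring.
move=> _ [x' [z' [w' ->]]].
have -> : qhom m x' (harm_coef m * x') z' w' = x' *: qhom m 1 (harm_coef m) 0 0 +
    (z' *: qhom m 0 0 1 0 + w' *: qhom m 0 0 0 1).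
  by rewrite !qhomZ !qhomD !(mulr0, mulr1, addr0, add0r) mulrC.
by case: Vodd => V3 V4; do ![apply: subspaceD => //]; apply: subspaceZ.
Qed.

Lemma line_irreducible m : irreducible (lie_k0 alpha) (line alpha lam m.+1).
Proof.
apply: irreducible_intro; first exact: line_submodule.
  exists (qhom m 1 m.+1%:R 0 0); first by rewrite lineS; exists 1; rewrite mulr1.
  by move=> /qhom_eq0[/eqP]; rewrite oner_eq0.
move=> V v [sV gV kV] VH Vv nv; rewrite lineS in VH *.
have [x vE] := VH _ Vv; rewrite {}vE in Vv nv.
have x0 : x != 0 by apply/eqP=> x0; apply: nv; rewrite x0 mulr0 qhom0.
move=> _ [y ->]; have := subspaceZ (y / x) sV Vv; congr V.
by rewrite qhomZ; congr qhom; field.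
Qed.

Lemma Fk_direct_sum m : alpha != -1 ->
  direct_sum (Fk alpha lam m.+1) (Hk alpha lam m.+1) (line alpha lam m.+1).
Proof.
move=> /beta_neqN1 b1.
rewrite FkS HkS lineS; split; apply/seteqP; split=> v.
- move=> [x [y [z [w ->]]]].
  exists (qhom m ((m.+1%:R * x - y) / (1 + beta))
    (harm_coef m * ((m.+1%:R * x - y) / (1 + beta))) z w).
  exists (qhom m ((y - harm_coef m * x) / (1 + beta))
     (m.+1%:R * ((y - harm_coef m * x) / (1 + beta))) 0 0).
  split; [by do 3!eexists|by eexists|rewrite qhomD /harm_coef -natr1].
  by congr qhom; field.
- move=> [_ [_ [[x [z [w ->]]] [y ->] ->]]]; rewrite qhomD.
  by do 4!eexists.
- move=> [[x [z [w ->]]] [y /qhom_inj[xy h z0 w0]]].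
  rewrite /= z0 w0 h xy; have y0 : y = 0; last by rewrite y0 mulr0 qhom0.
  apply/eqP; rewrite -(mulrI_eq0 _ (mulfI b1)); apply/eqP.
  rewrite xy /harm_coef -natr1 in h.
  have -> : (1 + beta) * y = (m%:R + 1) * y - (m%:R - beta) * y by ring.
  by rewrite h subrr.
- move=> ->; split; first by exists 0, 0, 0; rewrite mulr0 qhom0.
  by exists 0; rewrite mulr0 qhom0.
Qed.

(** From zp^(m+1) one reaches the odd vectors, then the harmonic vector, and the
    difference is (m - beta) zs zp^m. *)
Lemma qhoms_sub V m : subspace V -> (forall s t v, V v -> V (act (tkk_der s t) v)) ->
  V (qhom m 1 0 0 0) -> qhoms m `<=` V.
Proof.
move=> sV kV V1; have [] := even_to_odd sV kV V1.
  by rewrite mulr1 pnatr_eq0.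
move=> V3 V4; have Vh : V (qhom m 1 (harm_coef m) 0 0).
  by apply: (odd_to_harm sV kV V3) => -[/eqP]; rewrite oner_eq0.
have V2 : V (qhom m 0 1 0 0).
  apply: (subspaceZI sV (harm_coef_neq0 m)).
  have := subspaceD sV Vh (subspaceZ (-1) sV V1).
  by rewrite !qhomZ qhomD; congr V; congr qhom; ring.
by move=> _ [x [y [z [w ->]]]]; apply: qhom_in.
Qed.

Lemma Fk_irreducible k : irreducible (lie_k alpha) (Fk alpha lam k).
Proof.
case: k => [|m].
  apply: irreducible_intro; first exact: Fk_submodule.
    exists (qlift 1%:P 0 0 0); first by rewrite Fk0; exists 1.
    by move=> /qlift_eq0[/eqP]; rewrite oner_eq0.
  move=> V v [sV _ _] VF Vv nv; rewrite Fk0 in VF *.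
  have [c vE] := VF _ Vv; rewrite {}vE in Vv nv.
  have c0 : c != 0 by apply/eqP=> c0; apply: nv; rewrite c0 qlift0.
  move=> _ [d ->]; have := subspaceZ (d / c) sV Vv; congr V.
  by rewrite qliftZ !scaler0 -mul_polyC -polyCM mulfVK.
apply: irreducible_intro; first exact: Fk_submodule.
  exists (qhom m 1 0 0 0); first by rewrite FkS; do 4!eexists.
  by move=> /qhom_eq0[/eqP]; rewrite oner_eq0.
move=> V v mV VF Vv nv; rewrite FkS in VF *.
have [sV gV kV] := mV; have dV := tkk_der_stable lie_k0_k mV.
have [x [y [z [w vE]]]] := VF _ Vv; rewrite {}vE in Vv nv.
have Vo := odd_in gV Vv; have Ve := even_in gV Vv.
have kV' X u : lie_k alpha X -> V u -> V (act X u) by exact: kV.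
have from_top (x' y' : C) : x' != 0 -> V (qhom m x' y' 0 0) -> qhoms m `<=` V.
  move=> x0 /(zp_term_in sV kV') Vx; apply: (qhoms_sub sV dV).
  by apply: (subspaceZI sV x0); rewrite qhomZ mulr1 !mulr0.
have from_odd (z' w' : C) : (z', w') <> (0, 0) -> V (qhom m 0 0 z' w') -> qhoms m `<=` V.
  move=> zw Vzw; apply: (from_top 1 (harm_coef m)); first exact: oner_neq0.
  exact: (odd_to_harm sV dV Vzw zw).
have [x0|x0] := eqVneq x 0; last exact: (from_top x y).
have [y0|y0] := eqVneq y 0.
  apply: (from_odd z w) => // -[z0 w0].
  by apply: nv; rewrite x0 y0 z0 w0 qhom0.
have [|V3 _] := even_to_odd sV dV Ve; first by rewrite x0 mulr0 eq_sym.
by apply: (from_odd 1 0) => // -[/eqP]; rewrite oner_eq0.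
Qed.

Lemma harm_coef_N1 m : alpha = -1 -> harm_coef m = m.+1%:R.
Proof.
move=> aN1; rewrite /harm_coef aN1 -natr1; congr (_ + _).
by case: (b); rewrite ?invrN ?invr1 rmorphN rmorph1 opprK.
Qed.

(** When alpha = -1 the harmonic vector has zero defect, and every nonzero vector
    outside its line leads to it. *)
Lemma submodule_harm V m v : alpha = -1 -> submodule (lie_k0 alpha) V ->
  V `<=` qhoms m -> V v -> v <> 0 -> V (qhom m 1 (harm_coef m) 0 0).
Proof.
move=> aN1 mV VF Vv nv.
have [sV gV kV] := mV; have dV := tkk_der_stable (@subset_refl _ _) mV.
have [x [y [z [w vE]]]] := VF _ Vv; rewrite {}vE in Vv nv.
have Vo := odd_in gV Vv; have Ve := even_in gV Vv.
have [zw|zw] := pselect ((z, w) = (0, 0)); last exact: (odd_to_harm sV dV Vo zw).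
case: zw => z0 w0; have [xy|xy] := eqVneq (m.+1%:R * x) y; last first.
  have [V3 _] := even_to_odd sV dV Ve xy.
  by apply: (odd_to_harm sV dV V3) => -[/eqP]; rewrite oner_eq0.
have x0 : x != 0.
  by apply/eqP=> x0; apply: nv; rewrite z0 w0 -xy x0 mulr0 qhom0.
apply: (subspaceZI sV x0); move: Ve; congr V.
by rewrite -xy qhomZ harm_coef_N1 //; congr qhom; ring.
Qed.

Lemma Fk_neq0 m : Fk alpha lam m.+1 <> [set 0].
Proof.
rewrite FkS => F0; have : qhoms m (qhom m 1 0 0 0) by do 4!eexists.
by rewrite F0 => /qhom_eq0[/eqP]; rewrite oner_eq0.
Qed.

Lemma Fk_indecomposable m : alpha = -1 ->
  indecomposable (lie_k0 alpha) (Fk alpha lam m.+1).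
Proof.
move=> aN1; split; [exact/submodule_k0/Fk_submodule|exact: Fk_neq0|].
move=> U V mU mV [WE UV0].
have [sU _ _] := mU; have [sV _ _] := mV.
have [|nU] := pselect (U = [set 0]); first by left.
have [|nV] := pselect (V = [set 0]); first by right.
have UW : U `<=` qhoms m.
  move=> u Uu; rewrite -FkS WE; exists u, 0; split=> //; last by rewrite addr0.
  by case: sV.
have VW : V `<=` qhoms m.
  move=> u Uu; rewrite -FkS WE; exists 0, u; split=> //; last by rewrite add0r.
  by case: sU.
have [u Uu nu] := neq_set0 sU nU; have [v Vv nv] := neq_set0 sV nV.
have : (U `&` V) (qhom m 1 (harm_coef m) 0 0).
  by split; [exact: (submodule_harm aN1 mU UW Uu nu)
            |exact: (submodule_harm aN1 mV VW Vv nv)].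
by rewrite UV0 => /qhom_eq0[/eqP]; rewrite oner_eq0.
Qed.

Lemma Fk_reducible m : alpha = -1 -> ~ irreducible (lie_k0 alpha) (Fk alpha lam m.+1).
Proof.
move=> aN1 [_ _ /(_ (line alpha lam m.+1))]; rewrite FkS.
case; first exact: line_submodule.
- by rewrite lineS => _ [x ->]; do 4!eexists.
- rewrite lineS => /seteqP[h _].
  have : [set 0] (qhom m 1 m.+1%:R 0 0) by apply: h; exists 1; rewrite mulr1.
  by move=> /qhom_eq0[/eqP]; rewrite oner_eq0.
- rewrite lineS => /seteqP[_ h].
  have /h[x] : qhoms m (qhom m 0 0 1 0) by do 4!eexists.
  by move=> /qhom_inj[_ _ /eqP]; rewrite oner_eq0.
Qed.

(** * The module over g *)

Lemma coef_bessel_poly c (f : {poly C}) j :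
  (bessel_poly c f)`_j = j.+1%:R * (j%:R + c) * f`_j.+1.
Proof.
rewrite /bessel_poly coefD coefZ coefXM !coef_deriv.
by case: j => [|j] /=; ring.
Qed.

Lemma size_bessel_poly c (f : {poly C}) n :
  (size f <= n.+1)%N -> (size (bessel_poly c f) <= n)%N.
Proof.
move=> /leq_sizeP hf; apply/leq_sizeP => j hj.
by rewrite coef_bessel_poly hf ?mulr0.
Qed.

Lemma bessel_poly_eq0 c (f : {poly C}) :
  (forall j, j%:R + c != 0) -> bessel_poly c f = 0 ->
  (size f <= 1)%N.
Proof.
move=> hc f0; apply/leq_sizeP => -[//|j] _; apply/eqP.
have := coef_bessel_poly c f j; rewrite f0 coef0 => /esym/eqP.
by rewrite !mulf_eq0 pnatr_eq0 (negPf (hc j)).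
Qed.

Lemma bessel_polyC c d : bessel_poly c d%:P = 0.
Proof. by rewrite /bessel_poly derivC deriv0 mulr0 scaler0 addr0. Qed.

Section Stable.
Variable V : set Q.
Hypothesis sV : subspace V.
Hypothesis ZV : forall v, V v -> V (qmul_zp v).
Hypothesis BV : forall v, V v -> V (qbessel v).
Hypothesis dV : forall s t v, V v -> V (act (tkk_der s t) v).

(** Applying the Bessel operator until the result would vanish. *)
Lemma const_in n v : V v -> v <> 0 ->
  (size (qp v) <= n.+1)%N -> (size (qs v) <= n.+1)%N ->
  (size (q3 v) <= n.+1)%N -> (size (q4 v) <= n.+1)%N ->
  exists x y z w, V (qlift x%:P y%:P z%:P w%:P) /\ qlift x%:P y%:P z%:P w%:P <> 0.
Proof.
have base u : V u -> u <> 0 -> (size (qp u) <= 1)%N -> (size (qs u) <= 1)%N ->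
    (size (q3 u) <= 1)%N -> (size (q4 u) <= 1)%N ->
    exists x y z w, V (qlift x%:P y%:P z%:P w%:P) /\ qlift x%:P y%:P z%:P w%:P <> 0.
  move=> Vu nu /size1_polyC h1 /size1_polyC h2 /size1_polyC h3 /size1_polyC h4.
  exists (qp u)`_0, (qs u)`_0, (q3 u)`_0, (q4 u)`_0.
  by rewrite -h1 -h2 -h3 -h4 -qlift_eta.
elim: n v => [|n IHn] v Vv nv h1 h2 h3 h4; first exact: base nv h1 h2 h3 h4.
have [B0|nB] := pselect (qbessel v = 0); last first.
  by apply: (IHn (qbessel v) (BV Vv) nB); rewrite /qbessel !q_qlift size_bessel_poly.
have c1 j : j%:R + - beta != 0 :> C by rewrite subr_eq0 betaN.
have c2 j : j%:R + (1 - beta) != 0 :> C.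
  by rewrite addrA natr1 subr_eq0 betaN.
have [b1 b2 b3 b4] := qlift_eq0 B0.
by apply: (base v Vv nv); [exact: bessel_poly_eq0 b1|exact: bessel_poly_eq0 b2
  |exact: bessel_poly_eq0 b3|exact: bessel_poly_eq0 b4].
Qed.

Lemma act_tkk_der_const s t x y z w :
  act (tkk_der s t) (qlift x%:P y%:P z%:P w%:P) =
  qlift ((2 * kap * (t%:C * z - s%:C * w)) *: 'X)
     (- beta * (2 * kap * (t%:C * z - s%:C * w)))%:P
     (- (s%:C * y))%:P (- (t%:C * y))%:P.
Proof.
rewrite (act_lie_k0 _ (tkk_der_k0 s t)).
rewrite (framed_odd_der s t) /qder !q_qlift !derivC.
by congr qlift; rewrite !mxE /= -!mul_polyC; ring.
Qed.

(** The Bessel operator sends a derivative of x + y zs + z z3 + w z4 to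
    - 2 kap beta (t z - s w), a nonzero constant for some (s, t) when z or w is
    not zero. *)
Lemma one_in x y z w : V (qlift x%:P y%:P z%:P w%:P) ->
  qlift x%:P y%:P z%:P w%:P <> 0 -> V (qlift 1 0 0 0).
Proof.
have xc s t x' y' z' w' : qbessel (act (tkk_der s t) (qlift x'%:P y'%:P z'%:P w'%:P)) =
    (- beta * (2 * kap * (t%:C * z' - s%:C * w'))) *: qlift 1 0 0 0.
  rewrite act_tkk_der_const /qbessel !q_qlift !bessel_polyC qliftZ !scaler0; congr qlift.
  by rewrite /bessel_poly derivZ derivX alg_polyC derivC mulr0 add0r scale_polyC alg_polyC.
have k2 : - beta * (2 * kap) != 0.
  rewrite !mulf_neq0 ?oppr_eq0 ?pnatr_eq0 ?kap_neq0 //.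
  by have := betaN 0; rewrite eq_sym.
have key s t x' y' z' w' : V (qlift x'%:P y'%:P z'%:P w'%:P) ->
    V ((- beta * (2 * kap) * (t%:C * z' - s%:C * w')) *: qlift 1 0 0 0).
  by move=> Vv; rewrite -mulrA -(xc s t x' y' z' w'); apply/BV/dV.
have from_z x' y' z' w' : V (qlift x'%:P y'%:P z'%:P w'%:P) ->
    z' != 0 -> V (qlift 1 0 0 0).
  move=> Vv z0; apply: (subspaceZI sV _ (key 0 1 _ _ _ _ Vv)).
  by rewrite mulf_neq0 // mul0r subr0 mul1r.
move=> Vv nv.
have [z0|z0] := eqVneq z 0; last exact: (from_z x y z w).
have [w0|w0] := eqVneq w 0; last first.
  apply: (subspaceZI sV _ (key 1 0 _ _ _ _ Vv)).
  by rewrite mulf_neq0 // mul0r sub0r mul1r oppr_eq0.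
have [y0|y0] := eqVneq y 0.
  have x0 : x != 0.
    by apply/eqP => x0; apply: nv; rewrite x0 y0 z0 w0 polyC0 qlift0.
  apply: (subspaceZI sV x0); move: Vv; rewrite qliftZ y0 z0 w0 polyC0 !scaler0.
  by rewrite alg_polyC.
(* A derivation moves the zs-coefficient to z3, which was just treated. *)
apply: (from_z 0 0 (- y) 0); last by rewrite oppr_eq0.
have := dV 1 0 Vv; congr V.
rewrite act_tkk_der_const z0 w0 mul0r !mulr0 subr0 mulr0 scale0r polyC0.
by rewrite rmorph1 rmorph0 mul1r mul0r mulr0 oppr0 polyC0.
Qed.

(** From 1 one obtains all zp^n, then everything by [qhoms_sub]. *)
Lemma stable_full : V (qlift 1 0 0 0) -> forall v, V v.
Proof.
move=> V1.
have VX n : V (qlift 'X^n 0 0 0).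
  elim: n => [|n IHn]; first by rewrite expr0.
  by have := ZV IHn; rewrite /qmul_zp !q_qlift !mulr0 exprS.
have Vh m : qhoms m `<=` V.
  apply: (qhoms_sub sV dV).
  by rewrite /qhom !scale0r scale1r.
have lin (phi : {poly C} -> Q) : phi 0 = 0 ->
    (forall c f g, phi (c *: f + g) = c *: phi f + phi g) ->
    (forall n, V (phi 'X^n)) -> forall f, V (phi f).
  move=> phi0 phiD Vphi f; rewrite -[f]coefK poly_def.
  elim/big_rec: _ => [|i g _ Vg]; first by rewrite phi0; case: sV.
  by rewrite phiD; case: sV => _; apply.
have hV m x y z w : V (qhom m x y z w) by apply: (Vh m); do 4!eexists.
move=> v; rewrite [v]qlift_eta.
move: (qp v) (qs v) (q3 v) (q4 v) => f g h l.
have -> : qlift f g h l = qlift f 0 0 0 +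
    (qlift 0 g 0 0 + (qlift 0 0 h 0 + qlift 0 0 0 l)).
  by rewrite !qliftD !(addr0, add0r).
apply: (subspaceD sV); last apply: (subspaceD sV); last apply: (subspaceD sV).
- apply: (lin (fun f => qlift f 0 0 0)) => [|c u1 u2|n]; rewrite ?qlift0 //.
  by rewrite qlift_linear !scaler0 !addr0.
- apply: (lin (fun f => qlift 0 f 0 0)) => [|c u1 u2|n]; rewrite ?qlift0 //.
    by rewrite qlift_linear !scaler0 !addr0.
  by have := hV n 0 1 0 0; rewrite /qhom !scale0r scale1r.
- apply: (lin (fun f => qlift 0 0 f 0)) => [|c u1 u2|n]; rewrite ?qlift0 //.
    by rewrite qlift_linear !scaler0 !addr0.
  by have := hV n 0 0 1 0; rewrite /qhom !scale0r scale1r.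
- apply: (lin (fun f => qlift 0 0 0 f)) => [|c u1 u2|n]; rewrite ?qlift0 //.
    by rewrite qlift_linear !scaler0 !addr0.
  by have := hV n 0 0 0 1; rewrite /qhom !scale0r scale1r.
Qed.

End Stable.

Lemma half_sum_diff (V : lmodType C) (u v : V) :
  ('i / 2) *: (- 'i *: (u + v)) + 2^-1 *: (u - v) = u /\
  ('i / 2) *: (- 'i *: (u + v)) - 2^-1 *: (u - v) = v.
Proof.
have -> : ('i / 2) *: (- 'i *: (u + v)) = 2^-1 *: (u + v).
  by rewrite scalerA mulrN mulrAC -expr2 sqr_i mulNr opprK mul1r.
have h : 2^-1 + 2^-1 = 1 :> C by field.
rewrite -scalerDr -scalerBr opprB; split.
  by rewrite addrACA subrr addr0 scalerDr -scalerDl h scale1r.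
by rewrite (addrC u) addrACA subrr addr0 scalerDr -scalerDl h scale1r.
Qed.

Lemma qmul_zp_act v :
  qmul_zp v = ('i / 2) *: act (Tkk e1 0 e1 Der0) v + act (Tkk 0 e1 0 Der0) v.
Proof.
have [-> ->] := act_raise_lower v.
by have [-> _] := half_sum_diff (qmul_zp v) (qbessel v).
Qed.

Lemma qbessel_act v :
  qbessel v = ('i / 2) *: act (Tkk e1 0 e1 Der0) v - act (Tkk 0 e1 0 Der0) v.
Proof.
have [-> ->] := act_raise_lower v.
by have [_ ->] := half_sum_diff (qmul_zp v) (qbessel v).
Qed.

Lemma stable_ops V : subspace V ->
  (forall v, V v -> V (act (Tkk e1 0 e1 Der0) v)) ->
  (forall v, V v -> V (act (Tkk 0 e1 0 Der0) v)) ->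
  (forall v, V v -> V (qmul_zp v)) /\ (forall v, V v -> V (qbessel v)).
Proof.
move=> sV h1 h2; split=> v Vv; rewrite ?qmul_zp_act ?qbessel_act.
  by apply: (subspaceD sV); [apply: (subspaceZ _ sV)|]; auto.
rewrite -[X in _ + X]scaleN1r.
by apply: (subspaceD sV); apply: (subspaceZ _ sV); auto.
Qed.

Lemma Fock_act X : (forall c u v, act X (c *: u + v) = c *: act X u + act X v) ->
  forall v, Fock v -> Fock (act X v).
Proof.
move=> actD v Fv.
have act0 : act X (0 : Q) = 0.
  by have := actD 1 0 0; rewrite !scale1r addr0 -{1}[act X 0]addr0 => /addrI/esym.
apply: (Fv [set u | Fock (act X u)]).
  have [F0 FD] : subspace Fock by exact: span_subspace.
  split; first by rewrite /= act0.
  by move=> c x y Fx Fy; rewrite /= actD; exact: (FD c _ _ Fx Fy).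
by move=> _ [s ->]; apply: span_gen; exists (X :: s).
Qed.

(** The generating vectors are closed under the operators of [stable_full]; these
    are linear on the quotient, so their span is stable too. *)
Lemma Fock_full : Fock = setT.
Proof.
apply/seteqP; split=> // v _.
have sF : subspace Fock by exact: span_subspace.
have ADD (U : lmodType C) (r c : C) (u u' w w' : U) :
    r *: ((c *: u + w) + (c *: u' + w')) = c *: (r *: (u + u')) + r *: (w + w').
  by rewrite !scalerDr !scalerA [c * r]mulrC addrACA.
have SUB (U : lmodType C) (r c : C) (u u' w w' : U) :
    r *: ((c *: u + w) - (c *: u' + w')) = c *: (r *: (u - u')) + r *: (w - w').
  by rewrite opprD !scalerBr !scalerDr !scalerN !scalerA [c * r]mulrC addrACA.
have lin T c u v' : qder T (c *: u + v') = c *: qder T u + qder T v'.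
  by have [] := q_op_linear c u v'.
have dV s t u : Fock u -> Fock (act (tkk_der s t) u).
  apply: Fock_act => c x y.
  by rewrite !(act_lie_k0 _ (tkk_der_k0 s t)) lin.
have [ZV BV] : (forall v, Fock v -> Fock (qmul_zp v)) /\
    (forall v, Fock v -> Fock (qbessel v)).
  apply: stable_ops => // u; apply: Fock_act => c x y.
    have [-> _] := act_raise_lower (c *: x + y).
    have [-> _] := act_raise_lower x.
    have [-> _] := act_raise_lower y.
    have [_ [-> ->]] := q_op_linear c x y.
    exact: ADD.
  have [_ ->] := act_raise_lower (c *: x + y).
  have [_ ->] := act_raise_lower x.
  have [_ ->] := act_raise_lower y.
  have [_ [-> ->]] := q_op_linear c x y.
  exact: SUB.
apply: (stable_full sF ZV dV).
by rewrite -pr_one; apply: span_gen; exists [::].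
Qed.

Lemma Fock_irreducible : irreducible (lie_g alpha) Fock.
Proof.
rewrite Fock_full; apply: irreducible_intro.
- by split=> //; apply/gradedP.
- exists (qlift 1%:P 0 0 0) => //.
  by move=> /qlift_eq0[/eqP]; rewrite oner_eq0.
move=> V v [sV gV kV] _ Vv nv u _.
have dV s t u' : V u' -> V (act (tkk_der s t) u') by exact: kV.
have [ZV BV] : (forall v, V v -> V (qmul_zp v)) /\ (forall v, V v -> V (qbessel v)).
  by apply: stable_ops => // u'; apply: kV.
pose N := (size (qp v) + size (qs v) + size (q3 v) + size (q4 v))%N.
have [||||x [y [z [w [Vc nc]]]]] := const_in BV (n := N) Vv nv.
- by rewrite /N leqW // -!addnA leq_addr.
- by rewrite /N leqW // -!addnA addnCA leq_addr.
- by rewrite /N leqW // addnAC leq_addl.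
- by rewrite /N leqW // leq_addl.
apply: (stable_full sV ZV dV).
exact: (one_in sV BV dV Vc nc).
Qed.

Lemma poly_trunc (f : {poly C}) n : (size f <= n)%N ->
  \sum_(k < n) f`_k *: 'X^k = f.
Proof.
move=> hf; rewrite -poly_def; apply/polyP => i; rewrite coef_poly.
by case: ltnP => // hi; rewrite nth_default // (leq_trans hf hi).
Qed.

Lemma qlift_sum n (f g h l : nat -> {poly C}) :
  \sum_(k < n) qlift (f k) (g k) (h k) (l k) =
  qlift (\sum_(k < n) f k) (\sum_(k < n) g k) (\sum_(k < n) h k) (\sum_(k < n) l k).
Proof.
elim: n => [|n IHn]; first by rewrite !big_ord0 qlift0.
by rewrite !big_ord_recr /= IHn qliftD.
Qed.

Lemma Fk_coef0 k v : Fk alpha lam k v -> forall j,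
  [/\ j != k -> (qp v)`_j = 0, j.+1 != k -> (qs v)`_j = 0,
      j.+1 != k -> (q3 v)`_j = 0 & j.+1 != k -> (q4 v)`_j = 0].
Proof.
case: k => [|m].
  rewrite Fk0 => -[c ->] j; rewrite !q_qlift !coef0 coefC.
  by split=> //; case: (j).
rewrite FkS => -[x [y [z [w ->]]]] j; rewrite !q_qlift !coefZ !coefXn eqSS.
by split=> /negPf ->; rewrite mulr0.
Qed.

Lemma Fk_coef_eq0 k v : Fk alpha lam k v -> (qp v)`_k = 0 ->
  (forall i, i.+1 = k -> [/\ (qs v)`_i = 0, (q3 v)`_i = 0 & (q4 v)`_i = 0]) -> v = 0.
Proof.
case: k => [|m].
  by rewrite Fk0 => -[c ->]; rewrite !q_qlift coefC /= => -> _; rewrite qlift0.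
rewrite FkS => -[x [y [z [w ->]]]]; rewrite !q_qlift !coefZ !coefXn !eqxx !mulr1.
move=> -> /(_ m erefl)[]; rewrite !coefZ !coefXn !eqxx !mulr1.
by move=> -> -> ->; rewrite qhom0.
Qed.

Lemma coef_sum_q (phi : Q -> {poly C}) (x : nat -> Q) n i :
  (forall c u v, phi (c *: u + v) = c *: phi u + phi v) ->
  (phi (\sum_(k < n) x k))`_i = \sum_(k < n) (phi (x k))`_i.
Proof.
move=> phiD; have phi0 : phi 0 = 0.
  by have := phiD 1 0 0; rewrite !scale1r addr0 -{1}[phi 0]addr0 => /addrI/esym.
elim: n => [|n IHn]; first by rewrite !big_ord0 phi0 coef0.
by rewrite !big_ord_recr /= -IHn -[X in phi (X + _)]scale1r phiD scale1r coefD.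
Qed.

Lemma Fock_direct_sum : direct_sum_nat Fock (Fk alpha lam).
Proof.
split.
  rewrite Fock_full; apply/seteqP; split=> // v _.
  pose N := (size (qp v) + size (qs v) + size (q3 v) + size (q4 v))%N.
  exists N.+1, (fun k => if k is m.+1
    then qhom m (qp v)`_m.+1 (qs v)`_m (q3 v)`_m (q4 v)`_m
    else qlift ((qp v)`_0)%:P 0 0 0); split.
    by case=> [|m]; [rewrite Fk0; eexists|rewrite FkS; do 4!eexists].
  have S := qlift_sum N (fun m => (qp v)`_m.+1 *: 'X^(m.+1)) (fun m => (qs v)`_m *: 'X^m)
    (fun m => (q3 v)`_m *: 'X^m) (fun m => (q4 v)`_m *: 'X^m).
  rewrite big_ord_recl; apply: (etrans _ (esym (congr1 (fun u => _ + u) S))).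
  rewrite qliftD !add0r {1}[v]qlift_eta; congr qlift.
  - rewrite -[LHS](poly_trunc (n := N.+1)); last first.
      by rewrite /N leqW // -!addnA leq_addr.
    by rewrite big_ord_recl /= expr0 alg_polyC.
  - by rewrite poly_trunc // /N -!addnA addnCA leq_addr.
  - by rewrite poly_trunc // /N addnAC leq_addl.
  - by rewrite poly_trunc // /N leq_addl.
move=> n x Fx x0 k kn.
have key (phi : Q -> {poly C}) i :
  (forall c u v, phi (c *: u + v) = c *: phi u + phi v) ->
  (forall j, j != k -> (phi (x j))`_i = 0) -> (phi (x k))`_i = 0.
  move=> phiD phij; have := coef_sum_q x n i phiD; rewrite x0.
  have -> : phi 0 = 0.
    by have := phiD 1 0 0; rewrite !scale1r addr0 -{1}[phi 0]addr0 => /addrI/esym.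
  rewrite coef0 (bigD1 (Ordinal kn)) //= big1 ?addr0 // => j.
  by rewrite -val_eqE /= => /phij.
have lq c u v := q_linear c u v.
apply: (Fk_coef_eq0 (Fx k)).
  apply: key => [c u v|j jk]; first by rewrite !lq.
  by have [+ _ _ _] := Fk_coef0 (Fx j) k; apply; rewrite eq_sym.
move=> i ik; split; (apply: key => [c u v|j jk]; [by rewrite !lq|]);
  have [_ h1 h2 h3] := Fk_coef0 (Fx j) i;
  [apply: h1|apply: h2|apply: h3]; by rewrite ik eq_sym.
Qed.

End FockQuotient.

Theorem theorem6p4 (R : realType) (alpha lam : R) :
  alpha != 0 -> alpha != 1 ->
  (lam = alpha /\ alpha \isn't a Num.nat) \/
  (lam = 1 /\ alpha^-1 \isn't a Num.nat) ->
  [/\ (alpha != -1 -> forall k : nat, (1 <= k)%N ->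
         [/\ irreducible (lie_k0 alpha) (Hk alpha lam k),
             irreducible (lie_k0 alpha) (line alpha lam k) &
             direct_sum (Fk alpha lam k) (Hk alpha lam k) (line alpha lam k)]),
      (alpha = -1 -> forall k : nat, (1 <= k)%N ->
         indecomposable (lie_k0 alpha) (Fk alpha lam k) /\
         ~ irreducible (lie_k0 alpha) (Fk alpha lam k)),
      (forall k : nat, irreducible (lie_k alpha) (Fk alpha lam k)) &
      irreducible (lie_g alpha) (Fock alpha lam) /\
      direct_sum_nat (Fock alpha lam) (Fk alpha lam)].
Proof.
move=> alpha0 alpha1 hlam.
have [b [lamE betaN]] : exists b : bool, lam = (if b then alpha else 1) /\
    forall n, n%:R != (if b then alpha else alpha^-1)%:C :> R[i].
  have notnat (x : R) : x \isn't a Num.nat -> forall n, n%:R != x%:C :> R[i].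
    move=> xN n; apply: contraNneq xN => /eqP.
    by rewrite -(rmorph_nat (real_complex R)) (inj_eq (@complexI R)) => /eqP <-.
  by case: hlam => -[-> /notnat]; [exists true|exists false].
rewrite lamE; split.
- move=> an1 [//|m] _; split.
  + exact: Hk_irreducible.
  + exact: line_irreducible.
  + exact: Fk_direct_sum.
- by move=> aN1 [//|m] _; split; [exact: Fk_indecomposable|exact: Fk_reducible].
- by move=> k; exact: Fk_irreducible.
- by split; [exact: Fock_irreducible|exact: Fock_direct_sum].
Qed.
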